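(* If a sequence of meromorphic almost periodic functions $f_n(z)$ on a horizontal strip $S$ converges uniformly inside $S$ (that is, uniformly with respect to the spherical metric $\rho$ on every substrip $S'\subset\subset S$), then the limit function $f(z)$ is a meromorphic almost periodic function on $S$.
   Context: A (horizontal) strip is a set $S=\{z\in\mathbb C: a<\operatorname{Im} z<b\}$ with $-\infty\le a<b\le\infty$. For $S'=\{z\in\mathbb C: \alpha<\operatorname{Im} z<\beta\}$, the notation $S'\subset\subset S$ means $a<\alpha<\beta<b$. A property is said to hold inside $S$ if it holds on every substrip $S'\subset\subset S$. $\rho$ denotes the spherical metric on $\overline{\mathbb C}=\mathbb C\cup\{\infty\}$. A set $E\subset\mathbb R$ is relatively dense if there is $L>0$ such that every segment $[t,t+L]$, $t\in\mathbb R$, meets $E$. A meromorphic function $f$ on $S$ is called a meromorphic almost periodic function on $S$ if for every $S'\subset\subset S$ and every $\varepsilon>0$ the set $\{\tau\in\mathbb R:\rho(f(z+\tau),f(z))<\varepsilon\ \ \forall z\in S'\}$ is relatively dense in $\mathbb R$.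
   Formalization: The conclusion allows the limit function to be identically infinity on S as the one exception, since the constants f_n = n converge uniformly in the spherical metric to infinity, which is not a meromorphic function. *)

(* Defs.v *)
From Stdlib Require Export Reals.
From Coquelicot Require Export Coquelicot.
Open Scope R_scope.

Inductive Cbar : Type :=
  | CFin : C -> Cbar
  | CInfty : Cbar.

(* Normalised as the chordal distance on the unit sphere; the geodesic
   distance is [2 * asin (rho p q / 2)], which is bi-Lipschitz equivalent and
   therefore has the same uniform limits and the same almost periods up to a
   change of epsilon. *)
Definition rho (p q : Cbar) : R :=
  match p, q with
  | CFin z, CFin w =>
      2 * Cmod (z - w) / (sqrt (1 + Cmod z ^ 2) * sqrt (1 + Cmod w ^ 2))
  | CFin z, CInfty | CInfty, CFin z => 2 / sqrt (1 + Cmod z ^ 2)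
  | CInfty, CInfty => 0
  end.

Definition strip (a b : Rbar) (z : C) : Prop :=
  Rbar_lt a (Im z) /\ Rbar_lt (Im z) b.

(* [alpha] and [beta] may be taken real: both lie strictly between [a] and
   [b]. *)
Definition substrip (alpha beta : R) (a b : Rbar) : Prop :=
  Rbar_lt a alpha /\ alpha < beta /\ Rbar_lt beta b.

Definition relatively_dense (E : R -> Prop) : Prop :=
  exists L : R, 0 < L /\
    forall t : R, exists tau : R, t <= tau <= t + L /\ E tau.

(* Meant for open [D]; values of [f] outside [D] are irrelevant.  Every point
   of [D] is either a point of holomorphy or a pole, that is, an isolated
   singularity at which the modulus tends to infinity.  In particular the
   constant [CInfty] is not meromorphic. *)
Definition meromorphic_on (D : C -> Prop) (f : C -> Cbar) : Prop :=
  forall z0 : C, D z0 ->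
    exists (g : C -> C) (r : posreal),
      (forall z : C, 0 < Cmod (z - z0) < r ->
         f z = CFin (g z) /\ @ex_derive C_AbsRing C_NormedModule g z) /\
      match f z0 with
      | CFin w => w = g z0 /\ @ex_derive C_AbsRing C_NormedModule g z0
      | CInfty =>
          filterlim (fun z : C => Cmod (g z))
            (@locally' C_UniformSpace z0) (Rbar_locally p_infty)
      end.

Definition meromorphic_almost_periodic (a b : Rbar) (f : C -> Cbar) : Prop :=
  meromorphic_on (strip a b) f /\
  forall alpha beta : R, substrip alpha beta a b ->
  forall eps : R, 0 < eps ->
    relatively_dense (fun tau : R =>
      forall z : C, strip alpha beta z ->
        rho (f (z + RtoC tau)%C) (f z) < eps).

Definition converges_uniformly_inside (a b : Rbar)
    (fn : nat -> C -> Cbar) (f : C -> Cbar) : Prop :=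
  forall alpha beta : R, substrip alpha beta a b ->
  forall eps : R, 0 < eps ->
    exists N : nat, forall n : nat, (N <= n)%nat ->
      forall z : C, strip alpha beta z -> rho (fn n z) (f z) < eps.

(* Main.v *)
Require Import Defs.
From Stdlib Require Import Reals Arith Lra Lia Psatz Classical.
From Coquelicot Require Import Coquelicot.
Open Scope R_scope.

(** Almost periodicity passes to the limit by the usual three-epsilon argument:
    on a substrip an [eps/3]-almost period of some [fn n] with [rho (fn n) f < eps/3]
    is an [eps]-almost period of [f] ([almost_periodic_limit]).  This only needs the
    triangle inequality for the chordal metric, obtained here by identifying [rho]
    with the Euclidean distance of stereographic images ([rho_stereo]).

    The substance is that the limit is meromorphic, or constantly infinite.  The
    meromorphy of a map [f] into the sphere is tested in two charts: near a point
    where [f] is not infinite the finite part of [f] has to be complex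
    differentiable, near a point where [f] is not zero the finite part of [1/f] has
    to be ([sph_hol]).  Inversion is an isometry of the sphere, so it exchanges the
    two charts and one of them suffices.  Near a point where the limit is finite, [f]
    and almost all [fn n] stay away from infinity; there the chordal and the Euclidean
    distances are comparable and the statement becomes the Weierstrass theorem: a
    uniform limit of holomorphic functions is holomorphic.

    The functions are only assumed to be differentiable at each point, so the
    classical route is followed.  [goursat] gives the vanishing of integrals over
    boundaries of rectangles, by bisection.  [cauchy_quotient] gives the vanishing of
    the integral of [(k z - k w) / (z - w)], by cutting out a small square around [w].
    Hence a holomorphic function satisfies the Cauchy formula on a square
    ([holomorphic_cauchy_rep]).  This formula, with continuity on the boundary, is the
    property [cauchy_rep], which survives uniform limits
    ([cauchy_rep_limit]).  Expanding the kernel [1 / (z - w)] in a geometric series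
    turns [cauchy_rep] into Taylor polynomials with remainder of any order
    ([cauchy_rep_taylor]).  These yield everything else: order two gives
    differentiability at the centre ([cauchy_rep_cdiff]), order three applied to
    [(z - p) * k z] gives removable singularities ([removable]), and all orders
    together give isolated zeros ([isolated_zeros]).

    Removability is what makes [1 / fn n] holomorphic at the poles of [fn n]
    ([meromorphic_sph_hol]).  Isolated zeros of [1 / f] show that a point where the
    limit is infinite is either an isolated pole or interior to the set where [f] is
    infinite ([infty_dichotomy]).  The latter case propagates along segments through
    the whole strip ([near_infty_spreads]), which is the second alternative; if it
    never occurs, [f] is meromorphic ([sph_hol_meromorphic]). *)

(** * Continuity and complex differentiability *)

Definition ccont (f : C -> C) (z : C) : Prop :=
  forall eps, 0 < eps -> exists delta, 0 < delta /\
    forall y, Cmod (y - z) < delta -> Cmod (f y - f z) < eps.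

(** Caratheodory's form of the derivative: the difference quotient extends
    continuously to [z].  It makes the product and quotient rules algebraic; the
    usual form is [cderiv_eps]. *)
Definition cderiv (f : C -> C) (z l : C) : Prop :=
  exists phi : C -> C, phi z = l /\ ccont phi z /\
    forall y, f y = (f z + phi y * (y - z))%C.

Definition cdiff (f : C -> C) (z : C) : Prop := exists l, cderiv f z l.

Lemma Cmod_sub_sym (x y : C) : Cmod (x - y) = Cmod (y - x).
Proof. rewrite <- (Cmod_opp (x - y)). f_equal. ring. Qed.

Lemma Cmod_sub_triangle (x y z : C) : Cmod (x - z) <= Cmod (x - y) + Cmod (y - z).
Proof. replace (x - z)%C with ((x - y) + (y - z))%C by ring. apply Cmod_triangle. Qed.

Lemma Cmod_le_add_sub (x y : C) : Cmod x <= Cmod y + Cmod (x - y).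
Proof. replace x with (y + (x - y))%C at 1 by ring. apply Cmod_triangle. Qed.

Lemma Cmod_sub_refl (x : C) : Cmod (x - x) = 0.
Proof. replace (x - x)%C with (RtoC 0) by ring. apply Cmod_0. Qed.

Lemma Cmod_sub_pos (x y : C) : x <> y -> 0 < Cmod (x - y).
Proof. intros H. apply Cmod_gt_0. now apply Cminus_eq_contra. Qed.

Lemma Cmod_sub_neq (x y : C) : 0 < Cmod (x - y) -> x <> y.
Proof. intros H E. subst. rewrite Cmod_sub_refl in H. lra. Qed.

(** Integrals below are estimated by components through this bound; the factor it
    loses is harmless because only orders of magnitude matter. *)
Lemma Cmod_le_Re_Im (z : C) : Cmod z <= Rabs (Re z) + Rabs (Im z).
Proof.
  unfold Cmod, Re, Im. apply Rsqr_incr_0_var.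
  - rewrite Rsqr_sqrt by nra. unfold Rsqr.
    pose proof (Rabs_pos (fst z)). pose proof (Rabs_pos (snd z)).
    rewrite <- (pow2_abs (fst z)), <- (pow2_abs (snd z)). nra.
  - pose proof (Rabs_pos (fst z)). pose proof (Rabs_pos (snd z)). lra.
Qed.

Lemma im_le_Cmod (z : C) : Rabs (Im z) <= Cmod z.
Proof. eapply Rle_trans; [apply Rmax_r | apply Rmax_Cmod]. Qed.

Lemma Cmod_real_diff (x y c : R) : Cmod ((x, c) - (y, c)) = Rabs (x - y).
Proof.
  replace ((x, c) - (y, c))%C with (RtoC (x - y)). apply Cmod_R.
  unfold RtoC, Cminus, Cplus, Copp; simpl; f_equal; ring.
Qed.

Lemma Cmod_imag_diff (x y c : R) : Cmod ((c, x) - (c, y)) = Rabs (x - y).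
Proof.
  replace ((c, x) - (c, y))%C with (Ci * RtoC (x - y))%C.
  rewrite Cmod_mult, Cmod_Ci, Cmod_R. ring.
  unfold Ci, RtoC, Cminus, Cplus, Copp, Cmult; simpl; f_equal; ring.
Qed.

Lemma ccont_const (c z : C) : ccont (fun _ => c) z.
Proof.
  intros e He. exists 1. split. lra. intros. now rewrite Cmod_sub_refl.
Qed.

Lemma ccont_id (z : C) : ccont (fun z => z) z.
Proof. intros e He. exists e. auto. Qed.

Lemma ccont_plus f g z : ccont f z -> ccont g z -> ccont (fun z => f z + g z)%C z.
Proof.
  intros Hf Hg e He.
  destruct (Hf (e / 2)) as (d1 & P1 & H1). lra.
  destruct (Hg (e / 2)) as (d2 & P2 & H2). lra.
  exists (Rmin d1 d2). split. apply Rmin_pos; auto. intros y Hy.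
  pose proof (Rmin_l d1 d2). pose proof (Rmin_r d1 d2).
  replace (f y + g y - (f z + g z))%C with ((f y - f z) + (g y - g z))%C by ring.
  eapply Rle_lt_trans. apply Cmod_triangle.
  specialize (H1 y ltac:(lra)). specialize (H2 y ltac:(lra)). lra.
Qed.

Lemma ccont_bounded f z : ccont f z ->
  exists delta, 0 < delta /\ forall y, Cmod (y - z) < delta -> Cmod (f y) <= Cmod (f z) + 1.
Proof.
  intros Hf. destruct (Hf 1) as (d & P & H). lra.
  exists d. split; auto. intros y Hy. specialize (H y Hy).
  pose proof (Cmod_le_add_sub (f y) (f z)). lra.
Qed.

Lemma ccont_mult f g z : ccont f z -> ccont g z -> ccont (fun z => f z * g z)%C z.
Proof.
  intros Hf Hg e He.
  destruct (ccont_bounded g z Hg) as (d0 & P0 & H0).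
  pose proof (Cmod_ge_0 (f z)) as Nf. pose proof (Cmod_ge_0 (g z)) as Ng.
  destruct (Hf (e / (2 * (Cmod (g z) + 1)))) as (d1 & P1 & H1).
  { apply Rdiv_lt_0_compat; lra. }
  destruct (Hg (e / (2 * (Cmod (f z) + 1)))) as (d2 & P2 & H2).
  { apply Rdiv_lt_0_compat; lra. }
  exists (Rmin d0 (Rmin d1 d2)). split. repeat apply Rmin_pos; auto. intros y Hy.
  pose proof (Rmin_l d1 d2). pose proof (Rmin_r d1 d2).
  pose proof (Rmin_l d0 (Rmin d1 d2)). pose proof (Rmin_r d0 (Rmin d1 d2)).
  replace (f y * g y - f z * g z)%C with ((f y - f z) * g y + f z * (g y - g z))%C by ring.
  eapply Rle_lt_trans. apply Cmod_triangle. rewrite !Cmod_mult.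
  specialize (H1 y ltac:(lra)). specialize (H2 y ltac:(lra)). specialize (H0 y ltac:(lra)).
  apply Rmult_lt_compat_r with (r := Cmod (g z) + 1) in H1; [|lra].
  apply Rmult_lt_compat_r with (r := Cmod (f z) + 1) in H2; [|lra].
  replace (e / (2 * (Cmod (g z) + 1)) * (Cmod (g z) + 1)) with (e / 2) in H1 by (field; lra).
  replace (e / (2 * (Cmod (f z) + 1)) * (Cmod (f z) + 1)) with (e / 2) in H2 by (field; lra).
  pose proof (Cmod_ge_0 (f y - f z)). pose proof (Cmod_ge_0 (g y - g z)).
  nra.
Qed.

Lemma ccont_inv f z : ccont f z -> f z <> 0 -> ccont (fun z => / f z)%C z.
Proof.
  intros Hf Hz e He. apply Cmod_gt_0 in Hz as Hp. set (m := Cmod (f z)) in *.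
  destruct (Hf (Rmin (m / 2) (e * (m * (m / 2))))) as (d & P & H).
  { apply Rmin_pos. lra. apply Rmult_lt_0_compat; nra. }
  exists d. split; auto. intros y Hy. specialize (H y Hy).
  pose proof (Rmin_l (m / 2) (e * (m * (m / 2)))).
  pose proof (Rmin_r (m / 2) (e * (m * (m / 2)))).
  assert (Hb : m / 2 < Cmod (f y)).
  { pose proof (Cmod_le_add_sub (f z) (f y)). rewrite Cmod_sub_sym in H2. fold m in H2. lra. }
  assert (Hy0 : f y <> 0). { apply Cmod_gt_0. lra. }
  replace (/ f y - / f z)%C with (- (f y - f z) * / (f y * f z))%C.
  2:{ field. auto. }
  rewrite Cmod_mult, Cmod_opp, Cmod_inv, Cmod_mult by (apply Cmult_neq_0; auto).
  fold m. apply Rmult_lt_reg_r with (Cmod (f y) * m). nra.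
  rewrite Rmult_assoc, Rinv_l by nra.
  assert (m * (m / 2) <= Cmod (f y) * m) by nra.
  apply Rmult_le_compat_l with (r := e) in H2; lra.
Qed.

Lemma ccont_eventually_eq f g z d : 0 < d ->
  (forall y, Cmod (y - z) < d -> f y = g y) -> ccont f z -> ccont g z.
Proof.
  intros Hd E Hf e He. destruct (Hf e He) as (d1 & P1 & H1).
  exists (Rmin d d1). split. apply Rmin_pos; auto. intros y Hy.
  pose proof (Rmin_l d d1). pose proof (Rmin_r d d1).
  rewrite <- (E y), <- (E z). apply H1. lra. rewrite Cmod_sub_refl; lra. lra.
Qed.

Lemma Ceq_decide (x y : C) : {x = y} + {x <> y}.
Proof.
  destruct x as [a b], y as [c d].
  destruct (Req_EM_T a c); [destruct (Req_EM_T b d)|]; subst; auto; right; congruence.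
Qed.

Lemma cderiv_eps f z l :
  cderiv f z l <->
  forall eps, 0 < eps -> exists delta, 0 < delta /\
    forall y, Cmod (y - z) < delta -> Cmod (f y - f z - l * (y - z)) <= eps * Cmod (y - z).
Proof.
  split.
  - intros (phi & <- & Hc & E) e He. destruct (Hc e He) as (d & P & H).
    exists d. split; auto. intros y Hy. rewrite (E y).
    replace (f z + phi y * (y - z) - f z - phi z * (y - z))%C
      with ((phi y - phi z) * (y - z))%C by ring.
    rewrite Cmod_mult. apply Rmult_le_compat_r. apply Cmod_ge_0. apply Rlt_le; auto.
  - intros H.
    exists (fun y => if Ceq_decide y z then l else ((f y - f z) / (y - z))%C).
    split; [|split].
    + destruct (Ceq_decide z z); congruence.
    + intros e He. destruct (H (e / 2)) as (d & P & Hd). lra.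
      exists d. split; auto. intros y Hy.
      destruct (Ceq_decide z z) as [_|n]; [|congruence].
      destruct (Ceq_decide y z) as [_|n]. rewrite Cmod_sub_refl; lra.
      specialize (Hd y Hy). pose proof (Cmod_sub_pos _ _ n).
      replace ((f y - f z) / (y - z) - l)%C with ((f y - f z - l * (y - z)) / (y - z))%C.
      2:{ field. now apply Cminus_eq_contra. }
      rewrite Cmod_div by now apply Cminus_eq_contra.
      apply Rmult_lt_reg_r with (Cmod (y - z)). auto.
      unfold Rdiv. rewrite Rmult_assoc, Rinv_l by lra. nra.
    + intros y. destruct (Ceq_decide y z) as [->|n]. ring.
      field. now apply Cminus_eq_contra.
Qed.

Lemma cderiv_ccont f z l : cderiv f z l -> ccont f z.
Proof.
  intros (phi & _ & Hc & E).
  apply (ccont_eventually_eq (fun y => f z + phi y * (y + - z))%C f z 1). lra.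
  intros y _. rewrite (E y). ring.
  repeat first [apply ccont_plus | apply ccont_mult | apply ccont_const | apply ccont_id | assumption].
Qed.

Lemma cdiff_ccont f z : cdiff f z -> ccont f z.
Proof. intros [l H]. eapply cderiv_ccont; eauto. Qed.

Lemma cderiv_eventually_eq f g z l d : 0 < d ->
  (forall y, Cmod (y - z) < d -> f y = g y) -> cderiv f z l -> cderiv g z l.
Proof.
  intros Hd E Hf. apply cderiv_eps. intros e He.
  destruct (proj1 (cderiv_eps _ _ _) Hf e He) as (d1 & P1 & H1).
  exists (Rmin d d1). split. apply Rmin_pos; auto. intros y Hy.
  pose proof (Rmin_l d d1). pose proof (Rmin_r d d1).
  rewrite <- (E y), <- (E z). apply H1. lra. rewrite Cmod_sub_refl; lra. lra.
Qed.

Lemma cderiv_const (c z : C) : cderiv (fun _ => c) z 0.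
Proof. exists (fun _ => 0). repeat split. apply ccont_const. intros; ring. Qed.

Lemma cderiv_id (z : C) : cderiv (fun z => z) z 1.
Proof. exists (fun _ => 1). repeat split. apply ccont_const. intros; ring. Qed.

Lemma cderiv_plus f g z l m : cderiv f z l -> cderiv g z m ->
  cderiv (fun z => f z + g z)%C z (l + m)%C.
Proof.
  intros (p & <- & Hp & Ep) (q & <- & Hq & Eq).
  exists (fun y => p y + q y)%C. split; [|split]. reflexivity. now apply ccont_plus.
  intros y. rewrite (Ep y), (Eq y). ring.
Qed.

Lemma cderiv_mult f g z l m : cderiv f z l -> cderiv g z m ->
  cderiv (fun z => f z * g z)%C z (l * g z + f z * m)%C.
Proof.
  intros Hf Hg. pose proof (cderiv_ccont _ _ _ Hg) as Cg.
  destruct Hf as (p & <- & Hp & Ep), Hg as (q & <- & Hq & Eq).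
  exists (fun y => p y * g y + f z * q y)%C. split; [|split]. reflexivity.
  repeat first [apply ccont_plus | apply ccont_mult | apply ccont_const | assumption].
  intros y. rewrite (Ep y), (Eq y). ring.
Qed.

Lemma cderiv_scal k f z l : cderiv f z l -> cderiv (fun z => k * f z)%C z (k * l)%C.
Proof.
  intros (p & <- & Hp & Ep). exists (fun y => k * p y)%C. split; [|split]. reflexivity.
  apply ccont_mult; auto. apply ccont_const. intros y. rewrite (Ep y). ring.
Qed.

Lemma cderiv_inv f z l : cderiv f z l -> f z <> 0 ->
  cderiv (fun z => / f z)%C z (- l / (f z * f z))%C.
Proof.
  intros Hf Hz. pose proof (cderiv_ccont _ _ _ Hf) as Cf.
  assert (Hn : exists d, 0 < d /\ forall y, Cmod (y - z) < d -> f y <> 0).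
  { apply Cmod_gt_0 in Hz. destruct (Cf _ Hz) as (d & P & H). exists d. split; auto.
    intros y Hy E. specialize (H y Hy). rewrite E, Cmod_sub_sym in H.
    replace (f z - 0)%C with (f z) in H by ring. lra. }
  destruct Hn as (d & P & Hn). destruct Hf as (p & <- & Hp & Ep).
  apply (cderiv_eventually_eq
    (fun y => / f z + (- p y * / (f y * f z)) * (y - z))%C _ _ _ d); auto.
  { intros y Hy. specialize (Hn y Hy).
    transitivity (/ f z + (- (f y - f z) * / (f y * f z)))%C. rewrite (Ep y) at 2. ring.
    field; auto. }
  exists (fun y => - p y * / (f y * f z))%C. split; [|split].
  - reflexivity.
  - apply ccont_mult. apply (ccont_eventually_eq (fun y => (-1) * p y)%C _ _ 1). lra.
    intros; ring. apply ccont_mult; auto. apply ccont_const.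
    apply ccont_inv. apply ccont_mult; auto. apply ccont_const.
    now apply Cmult_neq_0.
  - intros y. ring.
Qed.

(** * Integrals of complex-valued functions of a real variable *)

Definition path_cont (f : R -> C) (t : R) : Prop :=
  forall eps, 0 < eps -> exists delta, 0 < delta /\
    forall s, Rabs (s - t) < delta -> Cmod (f s - f t) < eps.

Definition CInt (f : R -> C) (a b : R) : C :=
  (RInt (fun t => Re (f t)) a b, RInt (fun t => Im (f t)) a b).

Lemma path_cont_hor f x c : ccont f (x, c) -> path_cont (fun t => f (t, c)) x.
Proof.
  intros H e He. destruct (H e He) as (d & P & Hd). exists d. split; auto.
  intros s Hs. apply Hd. now rewrite Cmod_real_diff.
Qed.

Lemma path_cont_ver f y a : ccont f (a, y) -> path_cont (fun t => f (a, t)) y.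
Proof.
  intros H e He. destruct (H e He) as (d & P & Hd). exists d. split; auto.
  intros s Hs. apply Hd. now rewrite Cmod_imag_diff.
Qed.

Lemma path_cont_Re f t : path_cont f t -> continuous (fun t => Re (f t)) t.
Proof.
  intros H. apply filterlim_locally. intros eps.
  destruct (H eps (cond_pos eps)) as (d & P & Hd).
  exists (mkposreal d P). intros s Hs. specialize (Hd s Hs).
  eapply Rle_lt_trans; [|apply Hd]. apply (re_le_Cmod (f s - f t)).
Qed.

Lemma path_cont_Im f t : path_cont f t -> continuous (fun t => Im (f t)) t.
Proof.
  intros H. apply filterlim_locally. intros eps.
  destruct (H eps (cond_pos eps)) as (d & P & Hd).
  exists (mkposreal d P). intros s Hs. specialize (Hd s Hs).
  eapply Rle_lt_trans; [|apply Hd]. apply (im_le_Cmod (f s - f t)).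
Qed.

Lemma path_cont_scal k f t : path_cont f t -> path_cont (fun t => k * f t)%C t.
Proof.
  intros Hf e He. pose proof (Cmod_ge_0 k).
  destruct (Hf (e / (Cmod k + 1))) as (d & Pd & Hd).
  { apply Rdiv_lt_0_compat; lra. }
  exists d. split; auto. intros s Hs. specialize (Hd s Hs).
  replace (k * f s - k * f t)%C with (k * (f s - f t))%C by ring. rewrite Cmod_mult.
  pose proof (Cmod_ge_0 (f s - f t)).
  apply Rmult_lt_compat_r with (r := Cmod k + 1) in Hd; [|lra].
  unfold Rdiv in Hd. rewrite Rmult_assoc, Rinv_l in Hd by lra. nra.
Qed.

Definition path_cont_on (f : R -> C) (a b : R) := forall t, a <= t <= b -> path_cont f t.

Lemma path_cont_on_ex_Re f a b : a <= b -> path_cont_on f a b -> ex_RInt (fun t => Re (f t)) a b.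
Proof.
  intros Hab H. apply (@ex_RInt_continuous R_CompleteNormedModule). intros t Ht.
  rewrite Rmin_left, Rmax_right in Ht by auto. apply path_cont_Re; auto.
Qed.

Lemma path_cont_on_ex_Im f a b : a <= b -> path_cont_on f a b -> ex_RInt (fun t => Im (f t)) a b.
Proof.
  intros Hab H. apply (@ex_RInt_continuous R_CompleteNormedModule). intros t Ht.
  rewrite Rmin_left, Rmax_right in Ht by auto. apply path_cont_Im; auto.
Qed.

Lemma CInt_ext f g a b : a <= b -> (forall t, a <= t <= b -> f t = g t) ->
  CInt f a b = CInt g a b.
Proof.
  intros Hab H. unfold CInt. f_equal; apply RInt_ext; intros t Ht;
  rewrite Rmin_left, Rmax_right in Ht by auto; rewrite H; auto; lra.
Qed.

Lemma CInt_plus f g a b : a <= b -> path_cont_on f a b -> path_cont_on g a b ->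
  CInt (fun t => f t + g t)%C a b = (CInt f a b + CInt g a b)%C.
Proof.
  intros Hab Hf Hg. apply injective_projections; simpl.
  - apply (RInt_plus (fun t => Re (f t)) (fun t => Re (g t))); apply path_cont_on_ex_Re; auto.
  - apply (RInt_plus (fun t => Im (f t)) (fun t => Im (g t))); apply path_cont_on_ex_Im; auto.
Qed.

Lemma RInt_lin2 (u v : R -> R) (p q a b : R) : ex_RInt u a b -> ex_RInt v a b ->
  RInt (fun t => p * u t + q * v t) a b = p * RInt u a b + q * RInt v a b.
Proof.
  intros Hu Hv. apply is_RInt_unique.
  apply (is_RInt_plus (fun t => p * u t) (fun t => q * v t)).
  - apply (is_RInt_scal u). now apply (RInt_correct u).
  - apply (is_RInt_scal v). now apply (RInt_correct v).
Qed.

Lemma CInt_scal f (k : C) a b : a <= b -> path_cont_on f a b ->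
  CInt (fun t => k * f t)%C a b = (k * CInt f a b)%C.
Proof.
  intros Hab Hf. pose proof (path_cont_on_ex_Re _ _ _ Hab Hf) as E1.
  pose proof (path_cont_on_ex_Im _ _ _ Hab Hf) as E2.
  apply injective_projections; simpl.
  - replace (fst k * RInt (fun t => Re (f t)) a b - snd k * RInt (fun t => Im (f t)) a b)
      with (fst k * RInt (fun t => Re (f t)) a b + (- snd k) * RInt (fun t => Im (f t)) a b) by ring.
    rewrite <- RInt_lin2 by auto. apply RInt_ext. intros. unfold Re, Im, Cmult; simpl. ring.
  - rewrite <- RInt_lin2 by auto. apply RInt_ext. intros. unfold Re, Im, Cmult; simpl. ring.
Qed.

Lemma CInt_Chasles f a m b : a <= m <= b -> path_cont_on f a b ->
  CInt f a b = (CInt f a m + CInt f m b)%C.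
Proof.
  intros Hab Hf. apply injective_projections; simpl; symmetry.
  - apply (RInt_Chasles (fun t => Re (f t))); apply path_cont_on_ex_Re; try lra; intros t Ht; apply Hf; lra.
  - apply (RInt_Chasles (fun t => Im (f t))); apply path_cont_on_ex_Im; try lra; intros t Ht; apply Hf; lra.
Qed.

(** The factor 2 comes from estimating real and imaginary parts separately. *)
Lemma CInt_bound f a b M : a <= b -> path_cont_on f a b ->
  (forall t, a <= t <= b -> Cmod (f t) <= M) -> Cmod (CInt f a b) <= 2 * (b - a) * M.
Proof.
  intros Hab Hf HM. eapply Rle_trans. apply Cmod_le_Re_Im. unfold CInt; simpl.
  assert (Rabs (RInt (fun t => Re (f t)) a b) <= (b - a) * M).
  { apply abs_RInt_le_const; auto. now apply path_cont_on_ex_Re.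
    intros. eapply Rle_trans. apply re_le_Cmod. auto. }
  assert (Rabs (RInt (fun t => Im (f t)) a b) <= (b - a) * M).
  { apply abs_RInt_le_const; auto. now apply path_cont_on_ex_Im.
    intros. eapply Rle_trans. apply im_le_Cmod. auto. }
  lra.
Qed.

Lemma CInt_derive (F f : R -> C) a b : a <= b -> path_cont_on f a b ->
  (forall t, a <= t <= b ->
     is_derive (fun t => Re (F t)) t (Re (f t)) /\ is_derive (fun t => Im (F t)) t (Im (f t))) ->
  CInt f a b = (F b - F a)%C.
Proof.
  intros Hab Hf HF. apply injective_projections; simpl.
  - apply is_RInt_unique. apply (is_RInt_derive (fun t => Re (F t))).
    intros t Ht. rewrite Rmin_left, Rmax_right in Ht by auto. now apply HF.
    intros t Ht. rewrite Rmin_left, Rmax_right in Ht by auto. apply path_cont_Re; auto.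
  - apply is_RInt_unique. apply (is_RInt_derive (fun t => Im (F t))).
    intros t Ht. rewrite Rmin_left, Rmax_right in Ht by auto. now apply HF.
    intros t Ht. rewrite Rmin_left, Rmax_right in Ht by auto. apply path_cont_Im; auto.
Qed.

Lemma is_derive_R_eps (u : R -> R) (x l : R) :
  (forall eps, 0 < eps -> exists delta, 0 < delta /\
    forall y, Rabs (y - x) < delta -> Rabs (u y - u x - l * (y - x)) <= eps * Rabs (y - x)) ->
  is_derive u x l.
Proof.
  intros H. apply is_derive_Reals. intros e He.
  destruct (H (e / 2)) as (d & P & Hd). lra.
  exists (mkposreal d P). intros h Hh Hlt. simpl in Hlt.
  specialize (Hd (x + h)). replace (x + h - x) with h in Hd by ring.
  specialize (Hd Hlt).
  replace ((u (x + h) - u x) / h - l) with ((u (x + h) - u x - l * h) / h) by (field; auto).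
  unfold Rdiv. rewrite Rabs_mult, Rabs_inv.
  apply Rabs_pos_lt in Hh. apply Rmult_lt_reg_r with (Rabs h); auto.
  rewrite Rmult_assoc, Rinv_l by lra. nra.
Qed.

(** The next two lemmas read a complex derivative as the derivative along a
    horizontal or vertical line, with factor [1] or [Ci] respectively. *)
Lemma cderiv_hor F l x c : cderiv F (x, c) l ->
  is_derive (fun t => Re (F (t, c))) x (Re l) /\ is_derive (fun t => Im (F (t, c))) x (Im l).
Proof.
  intros H. rewrite cderiv_eps in H.
  split; apply is_derive_R_eps; intros e He; destruct (H e He) as (d & P & Hd);
  exists d; split; auto; intros y Hy; specialize (Hd (y, c));
  rewrite Cmod_real_diff in Hd; specialize (Hd Hy); (eapply Rle_trans; [|apply Hd]).
  - eapply Rle_trans; [|apply re_le_Cmod]. right. f_equal.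
    unfold Re, Cminus, Cplus, Copp, Cmult; simpl. ring.
  - eapply Rle_trans; [|apply im_le_Cmod]. right. f_equal.
    unfold Im, Cminus, Cplus, Copp, Cmult; simpl. ring.
Qed.

Lemma cderiv_ver F l y a : cderiv F (a, y) l ->
  is_derive (fun t => Re (F (a, t))) y (Re (Ci * l)%C) /\
  is_derive (fun t => Im (F (a, t))) y (Im (Ci * l)%C).
Proof.
  intros H. rewrite cderiv_eps in H.
  split; apply is_derive_R_eps; intros e He; destruct (H e He) as (d & P & Hd);
  exists d; split; auto; intros s Hs; specialize (Hd (a, s));
  rewrite Cmod_imag_diff in Hd; specialize (Hd Hs); (eapply Rle_trans; [|apply Hd]).
  - eapply Rle_trans; [|apply re_le_Cmod]. right. f_equal.
    unfold Re, Cminus, Cplus, Copp, Cmult; simpl. ring.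
  - eapply Rle_trans; [|apply im_le_Cmod]. right. f_equal.
    unfold Im, Cminus, Cplus, Copp, Cmult; simpl. ring.
Qed.

(** * Integrals along the boundary of a rectangle *)

Definition rect_int (f : C -> C) (a b c d : R) : C :=
  (CInt (fun x => f (x, c)) a b - CInt (fun x => f (x, d)) a b
   + Ci * (CInt (fun y => f (b, y)) c d - CInt (fun y => f (a, y)) c d))%C.

Definition in_rect (a b c d : R) (z : C) : Prop := a <= Re z <= b /\ c <= Im z <= d.

Definition on_bdry (a b c d : R) (z : C) : Prop :=
  in_rect a b c d z /\ (Re z = a \/ Re z = b \/ Im z = c \/ Im z = d).

Definition cont_on_bdry (f : C -> C) (a b c d : R) : Prop :=
  a <= b /\ c <= d /\ forall z, on_bdry a b c d z -> ccont f z.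

Lemma cont_on_bdry_sides f a b c d : cont_on_bdry f a b c d ->
  a <= b /\ c <= d /\
  path_cont_on (fun x => f (x, c)) a b /\ path_cont_on (fun x => f (x, d)) a b /\
  path_cont_on (fun y => f (b, y)) c d /\ path_cont_on (fun y => f (a, y)) c d.
Proof.
  intros (H1 & H2 & H). split; [|split]; auto.
  unfold on_bdry, in_rect in H.
  repeat split; intros t Ht; [apply path_cont_hor|apply path_cont_hor|apply path_cont_ver|apply path_cont_ver];
  apply H; simpl; split; try lra; auto.
Qed.

Lemma rect_int_plus f g a b c d : cont_on_bdry f a b c d -> cont_on_bdry g a b c d ->
  rect_int (fun z => f z + g z)%C a b c d = (rect_int f a b c d + rect_int g a b c d)%C.
Proof.
  intros Hf Hg. destruct (cont_on_bdry_sides _ _ _ _ _ Hf) as (? & ? & ? & ? & ? & ?).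
  destruct (cont_on_bdry_sides _ _ _ _ _ Hg) as (_ & _ & ? & ? & ? & ?).
  unfold rect_int.
  rewrite (CInt_plus (fun x => f (x, c)) (fun x => g (x, c))),
   (CInt_plus (fun x => f (x, d)) (fun x => g (x, d))),
   (CInt_plus (fun x => f (b, x)) (fun x => g (b, x))),
   (CInt_plus (fun x => f (a, x)) (fun x => g (a, x))) by auto. ring.
Qed.

Lemma rect_int_scal f k a b c d : cont_on_bdry f a b c d ->
  rect_int (fun z => k * f z)%C a b c d = (k * rect_int f a b c d)%C.
Proof.
  intros Hf. destruct (cont_on_bdry_sides _ _ _ _ _ Hf) as (? & ? & ? & ? & ? & ?).
  unfold rect_int.
  rewrite (CInt_scal (fun x => f (x, c))), (CInt_scal (fun x => f (x, d))),
   (CInt_scal (fun x => f (b, x))), (CInt_scal (fun x => f (a, x))) by auto. ring.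
Qed.

Lemma rect_int_ext f g a b c d : a <= b -> c <= d ->
  (forall z, on_bdry a b c d z -> f z = g z) -> rect_int f a b c d = rect_int g a b c d.
Proof.
  intros Hab Hcd H. unfold on_bdry, in_rect in H. unfold rect_int.
  rewrite (CInt_ext (fun x => f (x, c)) (fun x => g (x, c))),
   (CInt_ext (fun x => f (x, d)) (fun x => g (x, d))),
   (CInt_ext (fun x => f (b, x)) (fun x => g (b, x))),
   (CInt_ext (fun x => f (a, x)) (fun x => g (a, x))); auto;
  intros; apply H; simpl; split; try lra; auto.
Qed.

Lemma rect_int_bound f a b c d M : cont_on_bdry f a b c d ->
  (forall z, on_bdry a b c d z -> Cmod (f z) <= M) ->
  Cmod (rect_int f a b c d) <= 4 * ((b - a) + (d - c)) * M.
Proof.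
  intros Hf HM. destruct (cont_on_bdry_sides _ _ _ _ _ Hf) as (? & ? & ? & ? & ? & ?).
  unfold on_bdry, in_rect in HM. unfold rect_int, Cminus.
  assert (B1 : Cmod (CInt (fun x => f (x, c)) a b) <= 2 * (b - a) * M).
  { apply CInt_bound; auto. intros; apply HM; simpl; split; try lra; auto. }
  assert (B2 : Cmod (CInt (fun x => f (x, d)) a b) <= 2 * (b - a) * M).
  { apply CInt_bound; auto. intros; apply HM; simpl; split; try lra; auto. }
  assert (B3 : Cmod (CInt (fun x => f (b, x)) c d) <= 2 * (d - c) * M).
  { apply CInt_bound; auto. intros; apply HM; simpl; split; try lra; auto. }
  assert (B4 : Cmod (CInt (fun x => f (a, x)) c d) <= 2 * (d - c) * M).
  { apply CInt_bound; auto. intros; apply HM; simpl; split; try lra; auto. }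
  eapply Rle_trans. apply Cmod_triangle. rewrite Cmod_mult, Cmod_Ci.
  eapply Rle_trans. apply Rplus_le_compat. apply Cmod_triangle.
  rewrite Rmult_1_l. apply Cmod_triangle. rewrite !Cmod_opp. lra.
Qed.

Lemma rect_int_split_x f a m b c d : a <= m <= b ->
  cont_on_bdry f a b c d ->
  rect_int f a b c d = (rect_int f a m c d + rect_int f m b c d)%C.
Proof.
  intros Hm Hf. destruct (cont_on_bdry_sides _ _ _ _ _ Hf) as (? & ? & ? & ? & ? & ?).
  unfold rect_int.
  rewrite (CInt_Chasles (fun x => f (x, c)) a m b), (CInt_Chasles (fun x => f (x, d)) a m b) by auto.
  ring.
Qed.

Lemma rect_int_split_y f a b c m d : c <= m <= d ->
  cont_on_bdry f a b c d ->
  rect_int f a b c d = (rect_int f a b c m + rect_int f a b m d)%C.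
Proof.
  intros Hm Hf. destruct (cont_on_bdry_sides _ _ _ _ _ Hf) as (? & ? & ? & ? & ? & ?).
  unfold rect_int.
  rewrite (CInt_Chasles (fun x => f (b, x)) c m d), (CInt_Chasles (fun x => f (a, x)) c m d) by auto.
  ring.
Qed.

(** On each side the integral is an increment of the primitive [F], and the four
    increments add up to zero around the closed contour. *)
Lemma rect_int_derive F f a b c d : cont_on_bdry f a b c d ->
  (forall z, on_bdry a b c d z -> cderiv F z (f z)) -> rect_int f a b c d = 0.
Proof.
  intros Hf HF. destruct (cont_on_bdry_sides _ _ _ _ _ Hf) as (? & ? & ? & ? & ? & ?).
  unfold on_bdry, in_rect in HF. unfold rect_int.
  rewrite (CInt_derive (fun x => F (x, c)) (fun x => f (x, c))); auto.
  2:{ intros. apply cderiv_hor. apply HF; simpl; split; try lra; auto. }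
  rewrite (CInt_derive (fun x => F (x, d)) (fun x => f (x, d))); auto.
  2:{ intros. apply cderiv_hor. apply HF; simpl; split; try lra; auto. }
  assert (V : forall e, (e = a \/ e = b) -> path_cont_on (fun y => f (e, y)) c d ->
     (Ci * CInt (fun y => f (e, y)) c d = F (e, d) - F (e, c))%C).
  { intros e He Hp. rewrite <- CInt_scal by auto.
    rewrite (CInt_derive (fun y => F (e, y)) (fun y => Ci * f (e, y))%C); auto.
    - intros t Ht. apply path_cont_scal; auto.
    - intros. apply cderiv_ver. apply HF; simpl; split; try lra; intuition. }
  replace (Ci * (CInt (fun y => f (b, y)) c d - CInt (fun y => f (a, y)) c d))%C
    with (Ci * CInt (fun y => f (b, y)) c d - Ci * CInt (fun y => f (a, y)) c d)%C by ring.
  rewrite !V by auto. ring.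
Qed.

(** * The theorems of Goursat and Cauchy for rectangles *)

Lemma pow2_inv_half (W : R) n : W / 2 ^ n = 2 * (W / 2 ^ S n).
Proof. simpl. field. apply pow_nonzero. lra. Qed.

Lemma nested_dyadic (u : nat -> R) (W : R) : 0 <= W ->
  (forall n, u n <= u (S n) <= u n + W / 2 ^ S n) ->
  exists x, forall n, u n <= x <= u n + W / 2 ^ n.
Proof.
  intros HW H.
  assert (Hw : forall n, 0 <= W / 2 ^ n).
  { intros n. apply Rdiv_le_0_compat; auto. apply pow_lt. lra. }
  assert (Hup : forall n k, u n <= u (n + k)%nat).
  { intros n k. induction k. rewrite Nat.add_0_r; lra.
    rewrite Nat.add_succ_r. specialize (H (n + k)%nat). lra. }
  assert (Hdn : forall n k, u (n + k)%nat + W / 2 ^ (n + k) <= u n + W / 2 ^ n).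
  { intros n k. induction k. rewrite Nat.add_0_r; lra.
    rewrite Nat.add_succ_r. specialize (H (n + k)%nat).
    pose proof (pow2_inv_half W (n + k)). lra. }
  assert (Hnm : forall n m, u m <= u n + W / 2 ^ n).
  { intros n m. destruct (Nat.le_ge_cases n m) as [L|L].
    - replace m with (n + (m - n))%nat by lia. specialize (Hdn n (m - n)%nat).
      specialize (Hw (n + (m - n))%nat). lra.
    - specialize (Hup m (n - m)%nat). replace (m + (n - m))%nat with n in Hup by lia.
      specialize (Hw n). lra. }
  destruct (completeness (fun x => exists n, x = u n)) as [x [Hx1 Hx2]].
  - exists (u 0%nat + W / 2 ^ 0). intros y [m ->]. apply Hnm.
  - exists (u 0%nat). eauto.
  - exists x. intros n. split. apply Hx1. eauto.
    apply Hx2. intros y [m ->]. apply Hnm.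
Qed.

Lemma rect_int_quarter f x y h k : 0 <= h -> 0 <= k ->
  (forall z, in_rect x (x + 2 * h) y (y + 2 * k) z -> ccont f z) ->
  rect_int f x (x + 2 * h) y (y + 2 * k) =
  (rect_int f x (x + h) y (y + k) + rect_int f (x + h) (x + h + h) y (y + k)
   + (rect_int f x (x + h) (y + k) (y + k + k)
      + rect_int f (x + h) (x + h + h) (y + k) (y + k + k)))%C.
Proof.
  intros Hh Hk Hc.
  assert (B : forall a b c d, x <= a -> a <= b -> b <= x + 2 * h -> y <= c -> c <= d ->
    d <= y + 2 * k -> cont_on_bdry f a b c d).
  { intros. repeat split; auto. intros z [[? ?] _]. apply Hc. split; lra. }
  replace (x + 2 * h) with (x + h + h) in * by ring.
  replace (y + 2 * k) with (y + k + k) in * by ring.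
  rewrite (rect_int_split_y f _ _ _ (y + k)) by (try apply B; lra).
  rewrite (rect_int_split_x f _ (x + h) _ y (y + k)) by (try apply B; lra).
  rewrite (rect_int_split_x f _ (x + h) _ (y + k) (y + k + k)) by (try apply B; lra).
  reflexivity.
Qed.

(** Lower left corner of a quarter whose boundary integral is at least a quarter of
    the integral around the whole rectangle [x, x+2h] by [y, y+2k]. *)
Definition quarter_corner (f : C -> C) (h k : R) (p : R * R) : R * R :=
  let (x, y) := p in
  let I := Cmod (rect_int f x (x + 2 * h) y (y + 2 * k)) in
  if Rle_dec (I / 4) (Cmod (rect_int f x (x + h) y (y + k))) then (x, y)
  else if Rle_dec (I / 4) (Cmod (rect_int f (x + h) (x + h + h) y (y + k))) then (x + h, y)
  else if Rle_dec (I / 4) (Cmod (rect_int f x (x + h) (y + k) (y + k + k))) then (x, y + k)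
  else (x + h, y + k).

Lemma quarter_corner_spec f h k x y : 0 <= h -> 0 <= k ->
  (forall z, in_rect x (x + 2 * h) y (y + 2 * k) z -> ccont f z) ->
  let (x', y') := quarter_corner f h k (x, y) in
  x <= x' <= x + h /\ y <= y' <= y + k /\
  Cmod (rect_int f x (x + 2 * h) y (y + 2 * k)) / 4 <=
  Cmod (rect_int f x' (x' + h) y' (y' + k)).
Proof.
  intros Hh Hk Hc. unfold quarter_corner.
  destruct Rle_dec as [H1|H1]. repeat split; auto; lra.
  destruct Rle_dec as [H2|H2]. repeat split; auto; lra.
  destruct Rle_dec as [H3|H3]. repeat split; auto; lra.
  repeat split; try lra.
  rewrite (rect_int_quarter f x y h k) in * by auto.
  match goal with |- Cmod (?p + ?q + (?s + ?t))%C / 4 <= _ =>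
    pose proof (Cmod_triangle (p + q) (s + t)); pose proof (Cmod_triangle p q);
    pose proof (Cmod_triangle s t) end.
  lra.
Qed.

Fixpoint bisect (f : C -> C) (A B x y : R) (n : nat) : R * R :=
  match n with
  | O => (x, y)
  | S m => quarter_corner f (A / 2 ^ S m) (B / 2 ^ S m) (bisect f A B x y m)
  end.

(** Bisection produces nested rectangles, similar to the original one, scaled by
    [2^-n], whose integrals are at least [4^-n] times the original integral.  At their
    common point [f] is affine up to an error [o(2^-n)]; affine functions have
    primitives and contribute nothing, so the integrals are [o(4^-n)]. *)
Theorem goursat f a b c d : a <= b -> c <= d ->
  (forall z, in_rect a b c d z -> cdiff f z) -> rect_int f a b c d = 0.
Proof.
  intros Hab Hcd Hf.
  set (A := b - a). set (B := d - c).
  set (u := fun n => fst (bisect f A B a c n)).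
  set (v := fun n => snd (bisect f A B a c n)).
  assert (HA : forall n, 0 <= A / 2 ^ n).
  { intros. apply Rdiv_le_0_compat. unfold A; lra. apply pow_lt. lra. }
  assert (HB : forall n, 0 <= B / 2 ^ n).
  { intros. apply Rdiv_le_0_compat. unfold B; lra. apply pow_lt. lra. }
  assert (Hinv : forall n,
    (a <= u n /\ u n + A / 2 ^ n <= b /\ c <= v n /\ v n + B / 2 ^ n <= d) /\
    (u n <= u (S n) <= u n + A / 2 ^ S n) /\ (v n <= v (S n) <= v n + B / 2 ^ S n) /\
    Cmod (rect_int f (u n) (u n + A / 2 ^ n) (v n) (v n + B / 2 ^ n)) / 4 <=
    Cmod (rect_int f (u (S n)) (u (S n) + A / 2 ^ S n) (v (S n)) (v (S n) + B / 2 ^ S n))).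
  { assert (Hstep : forall n,
      (a <= u n /\ u n + A / 2 ^ n <= b /\ c <= v n /\ v n + B / 2 ^ n <= d) ->
      (u n <= u (S n) <= u n + A / 2 ^ S n) /\ (v n <= v (S n) <= v n + B / 2 ^ S n) /\
      Cmod (rect_int f (u n) (u n + A / 2 ^ n) (v n) (v n + B / 2 ^ n)) / 4 <=
      Cmod (rect_int f (u (S n)) (u (S n) + A / 2 ^ S n) (v (S n)) (v (S n) + B / 2 ^ S n))).
    { intros n Hn. rewrite (pow2_inv_half A n), (pow2_inv_half B n) in *.
      assert (Hc : forall z, in_rect (u n) (u n + 2 * (A / 2 ^ S n)) (v n)
         (v n + 2 * (B / 2 ^ S n)) z -> ccont f z).
      { intros z [? ?]. apply cdiff_ccont, Hf. split; lra. }
      pose proof (quarter_corner_spec f _ _ _ _ (HA (S n)) (HB (S n)) Hc) as Q.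
      replace (quarter_corner f (A / 2 ^ S n) (B / 2 ^ S n) (u n, v n)) with (u (S n), v (S n)) in Q.
      exact Q.
      unfold u, v. rewrite <- !surjective_pairing. reflexivity. }
    assert (Hin : forall n, a <= u n /\ u n + A / 2 ^ n <= b /\ c <= v n /\ v n + B / 2 ^ n <= d).
    { induction n.
      - unfold u, v, A, B; simpl. lra.
      - specialize (Hstep n IHn).
        pose proof (pow2_inv_half A n). pose proof (pow2_inv_half B n). lra. }
    intros n. split; auto. }
  destruct (nested_dyadic u A) as [x Hx]. unfold A; lra. apply Hinv.
  destruct (nested_dyadic v B) as [y Hy]. unfold B; lra. apply Hinv.
  assert (Hpow : forall n, Cmod (rect_int f a b c d) <=
     4 ^ n * Cmod (rect_int f (u n) (u n + A / 2 ^ n) (v n) (v n + B / 2 ^ n))).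
  { induction n.
    - unfold u, v; simpl. rewrite Rmult_1_l. unfold Rdiv; rewrite Rinv_1, !Rmult_1_r.
      unfold A, B. replace (a + (b - a)) with b by ring. replace (c + (d - c)) with d by ring. lra.
    - destruct (Hinv n) as (_ & _ & _ & Q).
      apply Rmult_le_compat_l with (r := 4 ^ S n) in Q; [|apply pow_le; lra].
      simpl in *. lra. }
  assert (Hz : in_rect a b c d (x, y)).
  { specialize (Hx 0%nat). specialize (Hy 0%nat). destruct (Hinv 0%nat) as (? & _).
    split; simpl in *; lra. }
  destruct (Hf _ Hz) as [l Hl]. rewrite cderiv_eps in Hl.
  apply Cmod_eq_0. apply Rle_antisym; [|apply Cmod_ge_0].
  apply le_epsilon. intros e He. rewrite Rplus_0_l.
  set (D := A + B). assert (HD : 0 <= D) by (unfold D, A, B; lra).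
  (* The summand 1 keeps the denominator positive for a degenerate rectangle. *)
  set (e' := e / (4 * (D * D) + 1)).
  assert (HDD : 0 <= D * D) by now apply Rmult_le_pos.
  assert (He' : 0 < e') by (apply Rdiv_lt_0_compat; lra).
  destruct (Hl e' He') as (dl & Pd & Hd).
  assert (exists n, D / 2 ^ n < dl) as [n Hn].
  { destruct (Pow_x_infinity 2) with (b := D / dl + 1) as [N HN].
    rewrite Rabs_right; lra.
    exists N. specialize (HN N (le_n N)). rewrite Rabs_right in HN.
    2:{ apply Rle_ge, pow_le; lra. }
    assert (0 < 2 ^ N) by (apply pow_lt; lra).
    apply Rmult_lt_reg_r with (2 ^ N); auto. unfold Rdiv. rewrite Rmult_assoc, Rinv_l by lra.
    assert (D / dl < 2 ^ N) by lra. apply Rmult_lt_compat_r with (r := dl) in H0; auto.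
    unfold Rdiv in H0. rewrite Rmult_assoc, Rinv_l in H0 by lra. lra. }
  assert (E : D / 2 ^ n = A / 2 ^ n + B / 2 ^ n) by (unfold D, Rdiv; ring).
  destruct (Hinv n) as (Hin & _). specialize (Hx n). specialize (Hy n).
  set (a' := u n) in *. set (b' := a' + A / 2 ^ n) in *.
  set (c' := v n) in *. set (d' := c' + B / 2 ^ n) in *.
  specialize (HA n). specialize (HB n).
  assert (Hclose : forall z, on_bdry a' b' c' d' z -> Cmod (z - (x, y)) <= D / 2 ^ n).
  { intros z [[? ?] _]. eapply Rle_trans. apply Cmod_le_Re_Im.
    assert (Rabs (Re (z - (x, y))) <= A / 2 ^ n).
    { apply Rabs_le. unfold Re in *; simpl. unfold b' in *. lra. }
    assert (Rabs (Im (z - (x, y))) <= B / 2 ^ n).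
    { apply Rabs_le. unfold Im in *; simpl. unfold d' in *. lra. }
    lra. }
  set (aff := fun z : C => (f (x, y) + l * (z + - (x, y)))%C).
  set (err := fun z : C => (f z + (-1) * aff z)%C).
  assert (Caff : forall z, ccont aff z).
  { intros z. unfold aff.
    repeat first [apply ccont_plus | apply ccont_mult | apply ccont_const | apply ccont_id]. }
  assert (Hord : a' <= b' /\ c' <= d') by lra. destruct Hord as [Ho1 Ho2].
  assert (B1 : cont_on_bdry aff a' b' c' d'). { split; [|split]; auto. }
  assert (B2 : cont_on_bdry err a' b' c' d').
  { split; [|split]; auto. intros z [[? ?] _]. unfold err.
    apply ccont_plus. apply cdiff_ccont, Hf; split; lra.
    apply ccont_mult; auto. apply ccont_const. }
  (* The affine part has the quadratic primitive below. *)
  assert (I1 : rect_int aff a' b' c' d' = 0).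
  { apply (rect_int_derive (fun z => f (x, y) * z + l * (/ 2 * (z * z) + - (x, y) * z))%C); auto.
    intros z _. unfold aff.
    replace (f (x, y) + l * (z + - (x, y)))%C with
      (f (x, y) * 1 + l * (/ 2 * (1 * z + z * 1) + - (x, y) * 1))%C by field.
    pose proof (cderiv_id z) as D1. pose proof (cderiv_mult _ _ _ _ _ D1 D1) as D2.
    exact (cderiv_plus _ _ _ _ _ (cderiv_scal (f (x, y)) _ _ _ D1)
      (cderiv_scal l _ _ _ (cderiv_plus _ _ _ _ _ (cderiv_scal (/ 2)%C _ _ _ D2)
         (cderiv_scal (- (x, y))%C _ _ _ D1)))). }
  assert (I2 : rect_int f a' b' c' d' = rect_int err a' b' c' d').
  { transitivity (rect_int (fun z => aff z + err z)%C a' b' c' d').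
    - apply rect_int_ext; auto. intros. unfold err. ring.
    - rewrite rect_int_plus, I1 by auto. ring. }
  assert (I3 : Cmod (rect_int err a' b' c' d') <=
     4 * ((b' - a') + (d' - c')) * (e' * (D / 2 ^ n))).
  { apply rect_int_bound; auto. intros z Hz'. specialize (Hclose z Hz').
    replace (err z) with (f z - f (x, y) - l * (z - (x, y)))%C by (unfold err, aff; ring).
    eapply Rle_trans. apply Hd. lra. apply Rmult_le_compat_l; lra. }
  replace (b' - a' + (d' - c')) with (D / 2 ^ n) in I3 by (unfold b', a', d', c'; lra).
  eapply Rle_trans. apply (Hpow n). fold a' b' c' d'. rewrite I2.
  eapply Rle_trans. apply Rmult_le_compat_l. apply pow_le; lra. apply I3.
  replace (4 ^ n) with (2 ^ n * 2 ^ n). 2:{ rewrite <- Rpow_mult_distr. f_equal; lra. }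
  replace (2 ^ n * 2 ^ n * (4 * (D / 2 ^ n) * (e' * (D / 2 ^ n)))) with (e' * (4 * (D * D))).
  2:{ field. apply pow_nonzero; lra. }
  assert (He2 : e' * (4 * (D * D) + 1) = e) by (unfold e'; field; lra). lra.
Qed.

Lemma cdiff_quotient k w z : z <> w -> cdiff k z -> cdiff (fun z => (k z - k w) / (z - w))%C z.
Proof.
  intros Hz [l Hl]. eexists. apply (cderiv_mult (fun z => k z + - k w)%C (fun z => / (z + - w))%C).
  - apply cderiv_plus. exact Hl. apply cderiv_const.
  - apply cderiv_inv. apply cderiv_plus. apply cderiv_id. apply cderiv_const.
    now apply (Cminus_eq_contra).
Qed.

Lemma cdiff_quotient_bounded k w : cdiff k w -> exists M delta, 0 < delta /\
  forall z, z <> w -> Cmod (z - w) < delta -> Cmod ((k z - k w) / (z - w)) <= M.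
Proof.
  intros [l (phi & _ & Hc & E)]. destruct (ccont_bounded _ _ Hc) as (d & P & H).
  exists (Cmod (phi w) + 1), d. split; auto. intros z Hz Hd.
  rewrite (E z). replace ((k w + phi z * (z - w) - k w) / (z - w))%C with (phi z). auto.
  field. now apply Cminus_eq_contra.
Qed.

(** The quotient is holomorphic off [w] and bounded near [w].  Cutting along the
    sides of a square of half-width [s] around [w] leaves, by [goursat], only the
    integral around that square, which is O(s). *)
Theorem cauchy_quotient k w a b c d : a < Re w < b -> c < Im w < d ->
  (forall z, in_rect a b c d z -> cdiff k z) ->
  rect_int (fun z => (k z - k w) / (z - w))%C a b c d = 0.
Proof.
  intros Hre Him Hk. set (G := fun z => ((k z - k w) / (z - w))%C).
  assert (HG : forall z, in_rect a b c d z -> z <> w -> cdiff G z).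
  { intros. apply cdiff_quotient; auto. }
  destruct (cdiff_quotient_bounded k w) as (M & dl & Pd & HM).
  { apply Hk. split; lra. }
  assert (HM0 : 0 <= M).
  { eapply Rle_trans; [|apply (HM (w + RtoC (dl / 2))%C)]. apply Cmod_ge_0.
    - apply Cmod_sub_neq. replace (w + RtoC (dl / 2) - w)%C with (RtoC (dl / 2)) by ring.
      rewrite Cmod_R, Rabs_right; lra.
    - replace (w + RtoC (dl / 2) - w)%C with (RtoC (dl / 2)) by ring.
      rewrite Cmod_R, Rabs_right; lra. }
  apply Cmod_eq_0. apply Rle_antisym; [|apply Cmod_ge_0].
  apply le_epsilon. intros e He. rewrite Rplus_0_l.
  set (u := Re w) in *. set (v := Im w) in *.
  assert (exists s, 0 < s /\ s <= u - a /\ s <= b - u /\ s <= v - c /\ s <= d - v /\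
    2 * s < dl /\ 16 * s * M <= e) as (s & S0 & S1 & S2 & S3 & S4 & S5 & S6).
  { exists (Rmin (Rmin (Rmin (u - a) (b - u)) (Rmin (v - c) (d - v)))
            (Rmin (dl / 3) (e / (16 * (M + 1))))).
    assert (0 < e / (16 * (M + 1))) by (apply Rdiv_lt_0_compat; lra).
    set (s := Rmin _ _).
    assert (Hs : s <= Rmin (Rmin (u - a) (b - u)) (Rmin (v - c) (d - v)) /\
       s <= Rmin (dl / 3) (e / (16 * (M + 1)))) by (split; [apply Rmin_l | apply Rmin_r]).
    pose proof (Rmin_l (Rmin (u - a) (b - u)) (Rmin (v - c) (d - v))).
    pose proof (Rmin_r (Rmin (u - a) (b - u)) (Rmin (v - c) (d - v))).
    pose proof (Rmin_l (u - a) (b - u)). pose proof (Rmin_r (u - a) (b - u)).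
    pose proof (Rmin_l (v - c) (d - v)). pose proof (Rmin_r (v - c) (d - v)).
    pose proof (Rmin_l (dl / 3) (e / (16 * (M + 1)))).
    pose proof (Rmin_r (dl / 3) (e / (16 * (M + 1)))).
    assert (0 < s) by (repeat apply Rmin_pos; lra).
    repeat split; try lra.
    assert (s * (16 * (M + 1)) <= e).
    { apply Rle_trans with (e / (16 * (M + 1)) * (16 * (M + 1))).
      apply Rmult_le_compat_r; lra. right. field. lra. }
    nra. }
  assert (Hne : forall z, (Re z <= u - s \/ u + s <= Re z \/ Im z <= v - s \/ v + s <= Im z) -> z <> w).
  { intros z Hz ->. fold u v in Hz. lra. }
  assert (Hb : forall a' b' c' d', a <= a' -> a' <= b' -> b' <= b -> c <= c' -> c' <= d' -> d' <= d ->
     (a' <= u - s \/ u + s <= a') -> (b' <= u - s \/ u + s <= b') ->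
     (c' <= v - s \/ v + s <= c') -> (d' <= v - s \/ v + s <= d') -> cont_on_bdry G a' b' c' d').
  { intros. split; [|split]; auto. intros z [[? ?] Hz]. apply cdiff_ccont, HG. split; lra.
    apply Hne. lra. }
  (* Any subrectangle that misses the open square around w contributes nothing. *)
  assert (HZ : forall a' b' c' d', a <= a' -> a' <= b' -> b' <= b -> c <= c' -> c' <= d' -> d' <= d ->
     (b' <= u - s \/ u + s <= a' \/ d' <= v - s \/ v + s <= c') -> rect_int G a' b' c' d' = 0).
  { intros. apply goursat; auto. intros z [? ?]. apply HG. split; lra. apply Hne. lra. }
  rewrite (rect_int_split_x G a (u - s) b c d) by (try apply Hb; lra).
  rewrite (rect_int_split_x G (u - s) (u + s) b c d) by (try apply Hb; lra).
  rewrite (rect_int_split_y G (u - s) (u + s) c (v - s) d) by (try apply Hb; lra).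
  rewrite (rect_int_split_y G (u - s) (u + s) (v - s) (v + s) d) by (try apply Hb; lra).
  rewrite (HZ a (u - s) c d), (HZ (u + s) b c d), (HZ (u - s) (u + s) c (v - s)),
    (HZ (u - s) (u + s) (v + s) d) by lra.
  rewrite !Cplus_0_l, !Cplus_0_r.
  eapply Rle_trans. apply (rect_int_bound G _ _ _ _ M). apply Hb; lra.
  - intros z [[? ?] Hz]. apply HM. apply Hne; lra.
    eapply Rle_lt_trans. apply Cmod_le_Re_Im.
    assert (Rabs (Re (z - w)) <= s).
    { apply Rabs_le. unfold u, Re in *; simpl. lra. }
    assert (Rabs (Im (z - w)) <= s).
    { apply Rabs_le. unfold v, Im in *; simpl. lra. }
    lra.
  - replace (4 * (u + s - (u - s) + (v + s - (v - s))) * M) with (16 * s * M) by ring. auto.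
Qed.

(** * The Cauchy kernel on a square *)

Definition sq_int (f : C -> C) (p : C) (r : R) : C :=
  rect_int f (Re p - r) (Re p + r) (Im p - r) (Im p + r).

Definition on_sq (p : C) (r : R) : C -> Prop :=
  on_bdry (Re p - r) (Re p + r) (Im p - r) (Im p + r).

Lemma on_sq_bounds p r z : on_sq p r z -> r <= Cmod (z - p) <= 2 * r.
Proof.
  intros [[H1 H2] H]. split.
  - assert (Rabs (Re (z - p)) = r \/ Rabs (Im (z - p)) = r) as [E|E].
    { unfold Re, Im in *; simpl.
      destruct H as [H|[H|[H|H]]]; rewrite H; [left|left|right|right];
      (rewrite Rabs_left1 by lra; lra) || (rewrite Rabs_right by lra; lra). }
    rewrite <- E. apply re_le_Cmod. rewrite <- E. apply im_le_Cmod.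
  - eapply Rle_trans. apply Cmod_le_Re_Im.
    assert (Rabs (Re (z - p)) <= r) by (apply Rabs_le; unfold Re in *; simpl; lra).
    assert (Rabs (Im (z - p)) <= r) by (apply Rabs_le; unfold Im in *; simpl; lra).
    lra.
Qed.

Lemma on_sq_far p r z w : on_sq p r z -> Cmod (w - p) <= r / 2 -> r / 2 <= Cmod (z - w).
Proof.
  intros Hz Hw. pose proof (on_sq_bounds _ _ _ Hz).
  pose proof (Cmod_sub_triangle z w p). lra.
Qed.

Lemma cont_on_square_bdry f p r : 0 <= r -> (forall z, on_sq p r z -> ccont f z) ->
  cont_on_bdry f (Re p - r) (Re p + r) (Im p - r) (Im p + r).
Proof. intros Hr H. split; [lra|split; [lra|exact H]]. Qed.

Lemma sq_int_bound f p r M : 0 <= r -> (forall z, on_sq p r z -> ccont f z) ->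
  (forall z, on_sq p r z -> Cmod (f z) <= M) -> Cmod (sq_int f p r) <= 16 * r * M.
Proof.
  intros Hr Hc HM. eapply Rle_trans.
  apply (rect_int_bound f _ _ _ _ M). now apply cont_on_square_bdry. exact HM. right. ring.
Qed.

Lemma sq_int_plus f g p r : 0 <= r -> (forall z, on_sq p r z -> ccont f z) ->
  (forall z, on_sq p r z -> ccont g z) ->
  sq_int (fun z => f z + g z)%C p r = (sq_int f p r + sq_int g p r)%C.
Proof. intros. apply rect_int_plus; now apply cont_on_square_bdry. Qed.

Lemma sq_int_scal k f p r : 0 <= r -> (forall z, on_sq p r z -> ccont f z) ->
  sq_int (fun z => k * f z)%C p r = (k * sq_int f p r)%C.
Proof. intros. apply rect_int_scal; now apply cont_on_square_bdry. Qed.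

Lemma sq_int_ext f g p r : 0 <= r -> (forall z, on_sq p r z -> f z = g z) ->
  sq_int f p r = sq_int g p r.
Proof. intros. apply rect_int_ext; auto; lra. Qed.

Lemma ccont_sub_inv w z : z <> w -> ccont (fun z => / (z - w))%C z.
Proof.
  intros Hz. apply (ccont_inv (fun z => z + - w)%C).
  apply ccont_plus. apply ccont_id. apply ccont_const. now apply Cminus_eq_contra.
Qed.

Lemma ccont_pow f z n : ccont f z -> ccont (fun z => f z ^ n)%C z.
Proof.
  intros H. induction n; simpl. apply ccont_const. now apply ccont_mult.
Qed.

Fixpoint poly_sum (a : nat -> C) (x : C) (N : nat) : C :=
  match N with O => RtoC 0 | S n => (poly_sum a x n + a n * x ^ n)%C end.

Definition cauchy_coef (h : C -> C) p r (j : nat) : C :=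
  sq_int (fun z => h z * (/ (z - p)) ^ S j)%C p r.

(** Iterates [1/(z-w) = 1/(z-p) + (w-p)/((z-p)(z-w))]. *)
Lemma sq_expansion h p r w : 0 < r -> (forall z, on_sq p r z -> ccont h z) ->
  Cmod (w - p) <= r / 2 -> forall N,
  sq_int (fun z => h z * / (z - w))%C p r =
  (poly_sum (cauchy_coef h p r) (w - p) N +
   (w - p) ^ N * sq_int (fun z => h z * ((/ (z - p)) ^ N * / (z - w))) p r)%C.
Proof.
  intros Hr Hc Hw N.
  assert (Np : forall z, on_sq p r z -> z <> p).
  { intros z Hz. apply Cmod_sub_neq. apply on_sq_bounds in Hz. lra. }
  assert (Nw : forall z, on_sq p r z -> z <> w).
  { intros z Hz. apply Cmod_sub_neq. pose proof (on_sq_far _ _ _ _ Hz Hw). lra. }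
  induction N.
  - simpl. rewrite Cplus_0_l, Cmult_1_l. apply sq_int_ext. lra. intros. simpl. ring.
  - rewrite IHN. cbn [poly_sum]. rewrite <- Cplus_assoc. f_equal.
    unfold cauchy_coef.
    rewrite (sq_int_ext (fun z => h z * ((/ (z - p)) ^ N * / (z - w)))%C
      (fun z => h z * (/ (z - p)) ^ S N + (w - p) * (h z * ((/ (z - p)) ^ S N * / (z - w))))%C).
    2: lra.
    + rewrite sq_int_plus; [|lra| |].
      * rewrite sq_int_scal; [|lra|].
        -- rewrite Cpow_S. ring.
        -- intros z Hz. apply ccont_mult; auto. apply ccont_mult.
           apply (ccont_pow _ _ (S N)). apply ccont_sub_inv; auto. apply ccont_sub_inv; auto.
      * intros z Hz. apply ccont_mult; auto.
        apply (ccont_pow _ _ (S N)). apply ccont_sub_inv; auto.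
      * intros z Hz. apply ccont_mult. apply ccont_const. apply ccont_mult; auto. apply ccont_mult.
        apply (ccont_pow _ _ (S N)). apply ccont_sub_inv; auto. apply ccont_sub_inv; auto.
    + intros z Hz. rewrite Cpow_S. field. split; apply Cminus_eq_contra; auto.
Qed.

(** On the boundary [|z-p| >= r] and [|z-w| >= r/2], and the perimeter is [8r]. *)
Lemma sq_expansion_error h p r w M : 0 < r -> (forall z, on_sq p r z -> ccont h z) ->
  (forall z, on_sq p r z -> Cmod (h z) <= M) ->
  Cmod (w - p) <= r / 2 -> forall N,
  Cmod (sq_int (fun z => h z * / (z - w))%C p r - poly_sum (cauchy_coef h p r) (w - p) N)
  <= 32 * M * (Cmod (w - p) / r) ^ N.
Proof.
  intros Hr Hc HM Hw N. rewrite (sq_expansion h p r w Hr Hc Hw N).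
  match goal with |- Cmod (?A + ?B - ?A) <= _ => replace (A + B - A)%C with B by ring end.
  assert (Np : forall z, on_sq p r z -> z <> p).
  { intros z Hz. apply Cmod_sub_neq. apply on_sq_bounds in Hz. lra. }
  assert (Nw : forall z, on_sq p r z -> z <> w).
  { intros z Hz. apply Cmod_sub_neq. pose proof (on_sq_far _ _ _ _ Hz Hw). lra. }
  rewrite Cmod_mult, Cmod_pow.
  assert (Hp : 0 < r ^ N) by now apply pow_lt.
  eapply Rle_trans. apply Rmult_le_compat_l. apply pow_le, Cmod_ge_0.
  apply (sq_int_bound _ _ _ (M * ((/ r) ^ N * / (r / 2)))). lra.
  - intros z Hz. apply ccont_mult; auto. apply ccont_mult.
    apply ccont_pow. apply ccont_sub_inv; auto. apply ccont_sub_inv; auto.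
  - intros z Hz. rewrite !Cmod_mult, Cmod_pow.
    rewrite !Cmod_inv by (apply Cminus_eq_contra; auto).
    pose proof (on_sq_bounds _ _ _ Hz). pose proof (on_sq_far _ _ _ _ Hz Hw).
    apply Rmult_le_compat; auto. apply Cmod_ge_0.
    apply Rmult_le_pos. apply pow_le. left; apply Rinv_0_lt_compat; lra.
    left; apply Rinv_0_lt_compat; lra.
    apply Rmult_le_compat. apply pow_le. left; apply Rinv_0_lt_compat; lra.
    left; apply Rinv_0_lt_compat; lra.
    apply pow_incr. split. left; apply Rinv_0_lt_compat; lra.
    apply Rinv_le_contravar; lra. apply Rinv_le_contravar; lra.
  - right. unfold Rdiv. rewrite Rpow_mult_distr. field. lra.
Qed.

Lemma cderiv_pow f z l n : cderiv f z l ->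
  cderiv (fun z => f z ^ S n)%C z (RtoC (INR (S n)) * f z ^ n * l)%C.
Proof.
  intros H. induction n.
  - apply (cderiv_eventually_eq f _ _ _ 1). lra. intros; simpl; ring.
    simpl. replace (1 * 1 * l)%C with l by ring. exact H.
  - pose proof (cderiv_mult _ _ _ _ _ H IHn) as D.
    rewrite S_INR, RtoC_plus, Cpow_S.
    replace ((INR (S n) + 1) * (f z * f z ^ n) * l)%C with
      (l * f z ^ S n + f z * (INR (S n) * f z ^ n * l))%C by (rewrite Cpow_S; ring).
    exact D.
Qed.

Lemma sq_int_inv_pow p r n : 0 < r -> sq_int (fun z => (/ (z - p)) ^ S (S n))%C p r = 0.
Proof.
  intros Hr.
  assert (Np : forall z, on_sq p r z -> z <> p).
  { intros z Hz. apply Cmod_sub_neq. apply on_sq_bounds in Hz. lra. }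
  assert (Hn : INR (S n) <> 0) by (apply not_0_INR; lia).
  apply (rect_int_derive (fun z => - / RtoC (INR (S n)) * (/ (z - p)) ^ S n)%C).
  - apply cont_on_square_bdry. lra. intros z Hz. apply (ccont_pow _ _ (S (S n))). apply ccont_sub_inv; auto.
  - intros z Hz. specialize (Np z Hz).
    assert (D : cderiv (fun z => / (z + - p))%C z (- (1 + 0) / ((z + - p) * (z + - p)))%C).
    { apply (cderiv_inv (fun z => z + - p)%C).
      exact (cderiv_plus _ _ _ _ _ (cderiv_id z) (cderiv_const (- p)%C z)).
      now apply Cminus_eq_contra. }
    pose proof (cderiv_scal (- / RtoC (INR (S n)))%C _ _ _ (cderiv_pow _ _ _ n D)) as D2.
    match type of D2 with cderiv _ _ ?v =>
      replace ((/ (z - p)) ^ S (S n))%C with v end.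
    exact D2.
    rewrite !Cpow_S. change (z + - p)%C with (z - p)%C. field. split.
    now apply Cminus_eq_contra. intros E. apply RtoC_inj in E. auto.
Qed.

(** The constant [2 i pi] of the Cauchy formula, kept as an integral so that no
    arctangent has to be evaluated. *)
Definition winding (p : C) (r : R) : C := sq_int (fun z => / (z - p))%C p r.

(** In the expansion for [h = 1] all coefficients but the first vanish, since
    [1/(z-p)^(n+2)] has a primitive, and the remainder tends to zero. *)
Lemma sq_int_kernel p r w : 0 < r -> Cmod (w - p) <= r / 2 ->
  sq_int (fun z => / (z - w))%C p r = winding p r.
Proof.
  intros Hr Hw. apply Ceq_minus.
  apply Cmod_eq_0. apply Rle_antisym; [|apply Cmod_ge_0].
  assert (Hps : forall N, poly_sum (cauchy_coef (fun _ => RtoC 1) p r) (w - p) (S N) = winding p r).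
  { induction N.
    - simpl. rewrite Cplus_0_l, Cmult_1_r. unfold cauchy_coef, winding.
      apply sq_int_ext. lra. intros; simpl; ring.
    - cbn [poly_sum] in *. rewrite IHN.
      replace (cauchy_coef (fun _ => RtoC 1) p r (S N)) with (RtoC 0). ring.
      symmetry. rewrite <- (sq_int_inv_pow p r N Hr). unfold cauchy_coef.
      apply sq_int_ext. lra. intros; ring. }
  assert (HB : forall N, Cmod (sq_int (fun z => / (z - w))%C p r - winding p r) <= 32 * (/ 2) ^ S N).
  { intros N. rewrite <- (Hps N).
    rewrite (sq_int_ext (fun z => / (z - w))%C (fun z => 1 * / (z - w))%C) by (intros; (ring || lra)).
    eapply Rle_trans. apply (sq_expansion_error (fun _ => RtoC 1) p r w 1); auto.
    intros; apply ccont_const. intros; rewrite Cmod_1; lra.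
    apply Rmult_le_compat; try lra. apply pow_le. apply Rdiv_le_0_compat; auto. apply Cmod_ge_0.
    apply pow_incr. split. apply Rdiv_le_0_compat; auto. apply Cmod_ge_0.
    apply Rmult_le_reg_r with r; auto. unfold Rdiv. rewrite Rmult_assoc, Rinv_l by lra. lra. }
  apply le_epsilon. intros e He. rewrite Rplus_0_l.
  destruct (pow_lt_1_zero (/ 2)) with (y := e / 32) as [N HN].
  rewrite Rabs_right; lra. lra.
  specialize (HN (S N) ltac:(lia)). rewrite Rabs_right in HN. 2:{ apply Rle_ge, pow_le; lra. }
  specialize (HB N). lra.
Qed.

Lemma RInt_Im_pos f a b : a < b -> path_cont_on f a b ->
  (forall t, a <= t <= b -> 0 < Im (f t)) -> 0 < Im (CInt f a b).
Proof.
  intros Hab Hf H. simpl. apply RInt_gt_0; auto. intros; apply H; lra.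
  intros; apply path_cont_Im; auto.
Qed.

Lemma Re_Cinv_sign z : Re z <> 0 -> 0 < Re z * Re (/ z)%C.
Proof.
  intros H. unfold Re in *; simpl. assert (0 < fst z * fst z) by nra.
  replace (fst z * (fst z / _)) with (fst z * fst z / (fst z * (fst z * 1) + snd z * (snd z * 1))).
  apply Rdiv_lt_0_compat; nra. field. nra.
Qed.

Lemma Im_Cinv_sign z : Im z <> 0 -> Im z * Im (/ z)%C < 0.
Proof.
  intros H. unfold Im in *; simpl. assert (0 < snd z * snd z) by nra.
  replace (snd z * (- snd z / _)) with (- (snd z * snd z / (fst z * (fst z * 1) + snd z * (snd z * 1)))).
  apply Ropp_lt_gt_0_contravar. apply Rdiv_lt_0_compat; nra. field. nra.
Qed.

(** Each of the four sides contributes a positive imaginary part. *)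
Lemma winding_neq_0 p r : 0 < r -> winding p r <> 0.
Proof.
  intros Hr.
  assert (Np : forall z, on_sq p r z -> z <> p).
  { intros z Hz. apply Cmod_sub_neq. apply on_sq_bounds in Hz. lra. }
  assert (Hb : cont_on_bdry (fun z => / (z - p))%C (Re p - r) (Re p + r) (Im p - r) (Im p + r)).
  { apply cont_on_square_bdry. lra. intros; apply ccont_sub_inv; auto. }
  destruct (cont_on_bdry_sides _ _ _ _ _ Hb) as (O1 & O2 & P1 & P2 & P3 & P4).
  intros E. apply (f_equal Im) in E. unfold winding, sq_int, rect_int in E.
  assert (Hk : forall f a b (k : C), path_cont_on f a b -> path_cont_on (fun t => k * f t)%C a b).
  { intros f a b k Hp t Ht. apply path_cont_scal; auto. }
  set (g1 := fun x : R => (/ ((x, (Im p - r)%R) - p))%C) in *.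
  set (g2 := fun x : R => (/ ((x, (Im p + r)%R) - p))%C) in *.
  set (g3 := fun y : R => (/ (((Re p + r)%R, y) - p))%C) in *.
  set (g4 := fun y : R => (/ (((Re p - r)%R, y) - p))%C) in *.
  assert (E1 : 0 < Im (CInt g1 (Re p - r) (Re p + r))).
  { apply RInt_Im_pos; auto. lra. intros t Ht. pose proof (Im_Cinv_sign ((t, Im p - r)%R - p)) as S.
    fold (g1 t) in S. unfold Im, Cminus, Cplus, Copp in S; cbn [snd fst] in S. unfold Im. nra. }
  assert (E2 : 0 < Im (CInt (fun t => - (1) * g2 t)%C (Re p - r) (Re p + r))).
  { apply RInt_Im_pos; auto. lra. intros t Ht. pose proof (Im_Cinv_sign ((t, Im p + r)%R - p)) as S.
    fold (g2 t) in S. unfold Im, Cminus, Cplus, Copp in S; cbn [snd fst] in S.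
    replace (Im (- (1) * g2 t)%C) with (- snd (g2 t)) by (unfold Im; simpl; ring). nra. }
  assert (E3 : 0 < Im (CInt (fun t => Ci * g3 t)%C (Im p - r) (Im p + r))).
  { apply RInt_Im_pos; auto. lra. intros t Ht. pose proof (Re_Cinv_sign ((Re p + r, t)%R - p)) as S.
    fold (g3 t) in S. unfold Re, Cminus, Cplus, Copp in S; cbn [snd fst] in S.
    replace (Im (Ci * g3 t)%C) with (fst (g3 t)) by (unfold Im; simpl; ring). nra. }
  assert (E4 : 0 < Im (CInt (fun t => - Ci * g4 t)%C (Im p - r) (Im p + r))).
  { apply RInt_Im_pos; auto. lra. intros t Ht. pose proof (Re_Cinv_sign ((Re p - r, t)%R - p)) as S.
    fold (g4 t) in S. unfold Re, Cminus, Cplus, Copp in S; cbn [snd fst] in S.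
    replace (Im (- Ci * g4 t)%C) with (- fst (g4 t)) by (unfold Im; simpl; ring). nra. }
  rewrite CInt_scal in E2, E3, E4 by auto.
  match type of E with Im (?A - ?B + Ci * (?D - ?F)) = _ =>
    replace (A - B + Ci * (D - F))%C with (A + (- (1) * B) + (Ci * D + - Ci * F))%C in E by ring end.
  assert (Im_plus : forall x y : C, Im (x + y)%C = Im x + Im y) by reflexivity.
  rewrite !Im_plus, im_RtoC in E. lra.
Qed.

(** * Functions represented by the Cauchy formula *)

(** The Cauchy formula near the centre of a square.  Unlike differentiability it is
    expressed by an integral, so it passes to uniform limits, and Taylor expansions follow
    from it.  The bound on the boundary is part of the data, which
    spares an appeal to compactness. *)
Definition cauchy_rep (h : C -> C) (p : C) (r : R) : Prop :=
  0 < r /\ (forall z, on_sq p r z -> ccont h z) /\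
  (exists M, forall z, on_sq p r z -> Cmod (h z) <= M) /\
  forall w, Cmod (w - p) <= r / 2 ->
    sq_int (fun z => h z * / (z - w))%C p r = (winding p r * h w)%C.

Lemma near_center_Re_Im p r w : Cmod (w - p) <= r / 2 ->
  Rabs (Re w - Re p) <= r / 2 /\ Rabs (Im w - Im p) <= r / 2.
Proof.
  intros H. split; eapply Rle_trans; try apply H.
  apply (re_le_Cmod (w - p)). apply (im_le_Cmod (w - p)).
Qed.

Lemma in_square_close p r z : in_rect (Re p - r) (Re p + r) (Im p - r) (Im p + r) z ->
  Cmod (z - p) <= 2 * r.
Proof.
  intros [H1 H2]. eapply Rle_trans. apply Cmod_le_Re_Im.
  assert (Rabs (Re (z - p)) <= r) by (apply Rabs_le; unfold Re in *; simpl; lra).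
  assert (Rabs (Im (z - p)) <= r) by (apply Rabs_le; unfold Im in *; simpl; lra).
  lra.
Qed.

(** Write [k z = (k z - k w) + k w]: the first part integrates to zero against the
    kernel by [cauchy_quotient]. *)
Lemma holomorphic_cauchy_rep k p r M : 0 < r ->
  (forall z, Cmod (z - p) <= 2 * r -> cdiff k z /\ Cmod (k z) <= M) ->
  cauchy_rep k p r.
Proof.
  intros Hr Hk.
  assert (Hs : forall z, on_sq p r z -> Cmod (z - p) <= 2 * r) by (intros z Hz; apply on_sq_bounds in Hz; lra).
  assert (Hc : forall z, on_sq p r z -> ccont k z) by (intros; apply cdiff_ccont, Hk; auto).
  split; [|split; [|split]]; auto.
  - exists M. intros; apply Hk; auto.
  - intros w Hw.
    assert (Nw : forall z, on_sq p r z -> z <> w).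
    { intros z Hz. apply Cmod_sub_neq. pose proof (on_sq_far _ _ _ _ Hz Hw). lra. }
    destruct (near_center_Re_Im _ _ _ Hw) as [H1 H2]. apply Rabs_le_between in H1, H2.
    assert (Q : sq_int (fun z => (k z - k w) / (z - w))%C p r = 0).
    { apply cauchy_quotient; try lra. intros z Hz. apply Hk. now apply in_square_close. }
    rewrite (sq_int_ext _ (fun z => (k z - k w) / (z - w) + k w * / (z - w))%C).
    2: lra. 2:{ intros. field. apply Cminus_eq_contra; auto. }
    rewrite sq_int_plus, Q, sq_int_scal, sq_int_kernel; auto; try lra.
    + ring.
    + intros; apply ccont_sub_inv; auto.
    + intros. apply cdiff_ccont, cdiff_quotient; auto. apply Hk; auto.
    + intros. apply ccont_mult. apply ccont_const. apply ccont_sub_inv; auto.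
Qed.

Lemma cauchy_rep_limit (hn : nat -> C -> C) h p r : 0 < r ->
  (forall z, on_sq p r z -> ccont h z) ->
  (exists M, forall z, on_sq p r z -> Cmod (h z) <= M) ->
  (forall eps, 0 < eps -> exists n, cauchy_rep (hn n) p r /\
     forall z, Cmod (z - p) <= 2 * r -> Cmod (hn n z - h z) <= eps) ->
  cauchy_rep h p r.
Proof.
  intros Hr Hc HM Hlim. split; [|split; [|split]]; auto.
  intros w Hw. apply Ceq_minus.
  apply Cmod_eq_0. apply Rle_antisym; [|apply Cmod_ge_0].
  apply le_epsilon. intros e He. rewrite Rplus_0_l.
  pose proof (Cmod_ge_0 (winding p r)).
  assert (He' : 0 < e / (32 + Cmod (winding p r))) by (apply Rdiv_lt_0_compat; lra).
  destruct (Hlim _ He') as (n & (_ & Hcn & _ & Hn) & Hclose).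
  set (e' := e / (32 + Cmod (winding p r))) in *.
  assert (Nw : forall z, on_sq p r z -> z <> w).
  { intros z Hz. apply Cmod_sub_neq. pose proof (on_sq_far _ _ _ _ Hz Hw). lra. }
  specialize (Hn w Hw).
  assert (C1 : forall z, on_sq p r z -> ccont (fun z => hn n z * / (z - w))%C z).
  { intros. apply ccont_mult; auto. apply ccont_sub_inv; auto. }
  assert (C2 : forall z, on_sq p r z -> ccont (fun z => (h z + (-1) * hn n z) * / (z - w))%C z).
  { intros. apply ccont_mult; auto. apply ccont_plus; auto. apply ccont_mult; auto. apply ccont_const.
    apply ccont_sub_inv; auto. }
  assert (E : sq_int (fun z => h z * / (z - w))%C p r =
    (winding p r * hn n w + sq_int (fun z => (h z + (-1) * hn n z) * / (z - w)) p r)%C).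
  { rewrite <- Hn, <- sq_int_plus; auto; try lra. apply sq_int_ext. lra. intros; ring. }
  rewrite E.
  match goal with |- Cmod (?A * ?B + ?D - ?A * ?F) <= _ =>
    replace (A * B + D - A * F)%C with (A * (B - F) + D)%C by ring end.
  eapply Rle_trans. apply Cmod_triangle. rewrite Cmod_mult.
  assert (B1 : Cmod (hn n w - h w) <= e') by (apply Hclose; lra).
  assert (B2 : Cmod (sq_int (fun z => (h z + (-1) * hn n z) * / (z - w))%C p r) <= 16 * r * (e' * / (r / 2))).
  { apply sq_int_bound; auto. lra. intros z Hz. rewrite Cmod_mult, Cmod_inv by (apply Cminus_eq_contra; auto).
    apply Rmult_le_compat. apply Cmod_ge_0.
    left; apply Rinv_0_lt_compat, Cmod_sub_pos; auto.
    replace (h z + (-1) * hn n z)%C with (- (hn n z - h z))%C by ring. rewrite Cmod_opp.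
    apply Hclose. apply on_sq_bounds in Hz. lra.
    apply Rinv_le_contravar. lra. apply (on_sq_far p r); auto. }
  replace (16 * r * (e' * / (r / 2))) with (32 * e') in B2 by (field; lra).
  apply Rmult_le_compat_l with (r := Cmod (winding p r)) in B1; auto.
  assert ((32 + Cmod (winding p r)) * e' = e) by (unfold e'; field; lra). lra.
Qed.

(** The same coefficients serve every order, and the constant does not depend on it;
    the latter is what [isolated_zeros] needs when all coefficients vanish. *)
Definition taylor (h : C -> C) (p : C) (r : R) (a : nat -> C) (K : R) : Prop :=
  forall N w, Cmod (w - p) <= r / 2 ->
    Cmod (h w - poly_sum a (w - p) N) <= K * (Cmod (w - p) / r) ^ N.

Lemma poly_sum_scal (k : C) a x N : poly_sum (fun j => k * a j)%C x N = (k * poly_sum a x N)%C.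
Proof. induction N; simpl. ring. rewrite IHN. ring. Qed.

Lemma cauchy_rep_taylor h p r : cauchy_rep h p r -> exists a K, 0 <= K /\ taylor h p r a K.
Proof.
  intros (Hr & Hc & [M HM] & Hrep).
  pose proof (winding_neq_0 p r Hr) as Hw0. pose proof (Cmod_sub_pos _ _ Hw0) as Hwp.
  replace (winding p r - 0)%C with (winding p r) in Hwp by ring.
  exists (fun j => / winding p r * cauchy_coef h p r j)%C, (32 * Rmax M 0 * / Cmod (winding p r)).
  assert (HK : 0 <= Rmax M 0) by apply Rmax_r.
  split. { apply Rmult_le_pos. lra. left; now apply Rinv_0_lt_compat. }
  intros N w Hw. rewrite poly_sum_scal.
  replace (h w) with (/ winding p r * (winding p r * h w))%C by (field; auto).
  rewrite <- Hrep by auto.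
  match goal with |- Cmod (?A * ?B - ?A * ?F) <= _ =>
    replace (A * B - A * F)%C with (A * (B - F))%C by ring end.
  rewrite Cmod_mult, Cmod_inv by auto.
  eapply Rle_trans. apply Rmult_le_compat_l. left; now apply Rinv_0_lt_compat.
  apply (sq_expansion_error h p r w (Rmax M 0)); auto.
  intros. eapply Rle_trans. apply HM; auto. apply Rmax_l. right. ring.
Qed.

Lemma taylor_at_center h p r a K : 0 < r -> taylor h p r a K -> h p = a 0%nat.
Proof.
  intros Hr H. specialize (H 1%nat p). rewrite Cmod_sub_refl in H.
  specialize (H ltac:(lra)). simpl in H.
  apply Ceq_minus. apply Cmod_eq_0. apply Rle_antisym; [|apply Cmod_ge_0].
  replace (h p - a 0%nat)%C with (h p - (0 + a 0%nat * 1))%C by ring.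
  eapply Rle_trans. apply H. right. unfold Rdiv. ring.
Qed.

Lemma quadratic_error_cderiv h p l K d : 0 < d ->
  (forall w, Cmod (w - p) < d -> Cmod (h w - h p - l * (w - p)) <= K * (Cmod (w - p) * Cmod (w - p))) ->
  cderiv h p l.
Proof.
  intros Hd H. apply cderiv_eps. intros e He.
  pose proof (Rmax_l K 0). pose proof (Rmax_r K 0). set (K' := Rmax K 0) in *.
  assert (0 < e / (K' + 1)) by (apply Rdiv_lt_0_compat; lra).
  exists (Rmin d (e / (K' + 1))). split. now apply Rmin_pos.
  intros y Hy. pose proof (Rmin_l d (e / (K' + 1))). pose proof (Rmin_r d (e / (K' + 1))).
  eapply Rle_trans. apply H. lra.
  pose proof (Cmod_ge_0 (y - p)). rewrite <- Rmult_assoc. apply Rmult_le_compat_r; auto.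
  assert (Cmod (y - p) * (K' + 1) <= e).
  { replace e with (e / (K' + 1) * (K' + 1)) by (field; lra). apply Rmult_le_compat_r; lra. }
  nra.
Qed.

Lemma taylor_cderiv h p r a K : 0 < r -> taylor h p r a K -> cderiv h p (a 1%nat).
Proof.
  intros Hr H. pose proof (taylor_at_center _ _ _ _ _ Hr H) as E0.
  apply (quadratic_error_cderiv h p _ (K / (r * r)) (r / 2)). lra.
  intros w Hw. specialize (H 2%nat w ltac:(lra)). simpl in H. rewrite E0.
  replace (h w - a 0%nat - a 1%nat * (w - p))%C with
    (h w - (0 + a 0%nat * 1 + a 1%nat * ((w - p) * 1)))%C by ring.
  eapply Rle_trans. apply H. right. field. lra.
Qed.

Lemma cauchy_rep_cdiff h p r : cauchy_rep h p r -> cdiff h p.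
Proof.
  intros H. destruct (cauchy_rep_taylor _ _ _ H) as (a & K & _ & T).
  exists (a 1%nat). apply (taylor_cderiv h p r a K); auto. apply H.
Qed.

(** If all Taylor coefficients vanish, [|h w| <= K 2^-N] for every [N].  Otherwise the
    first nonzero term dominates the remainder near [p]. *)
Lemma isolated_zeros h p r : cauchy_rep h p r ->
  (forall w, Cmod (w - p) <= r / 2 -> h w = 0) \/
  exists d, 0 < d /\ forall w, 0 < Cmod (w - p) < d -> h w <> 0.
Proof.
  intros H. destruct (cauchy_rep_taylor _ _ _ H) as (a & K & HK & T).
  destruct H as (Hr & _).
  assert (Hps : forall N, (forall j, (j < N)%nat -> a j = 0) -> forall x, poly_sum a x N = 0).
  { induction N; intros Hj x; simpl. reflexivity.
    rewrite IHN, (Hj N) by auto. ring. }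
  destruct (classic (forall j, a j = 0)) as [Z|NZ].
  - left. intros w Hw. apply Cmod_eq_0. apply Rle_antisym; [|apply Cmod_ge_0].
    apply le_epsilon. intros e He. rewrite Rplus_0_l.
    destruct (pow_lt_1_zero (/ 2)) with (y := e / (K + 1)) as [N HN].
    rewrite Rabs_right; lra. apply Rdiv_lt_0_compat; lra.
    specialize (HN N (le_n N)). rewrite Rabs_right in HN. 2:{ apply Rle_ge, pow_le; lra. }
    specialize (T N w Hw). rewrite Hps in T by auto.
    replace (h w - 0)%C with (h w) in T by ring.
    eapply Rle_trans. apply T.
    assert ((Cmod (w - p) / r) ^ N <= (/ 2) ^ N).
    { apply pow_incr. split. apply Rdiv_le_0_compat; auto. apply Cmod_ge_0.
      apply Rmult_le_reg_r with r; auto. unfold Rdiv. rewrite Rmult_assoc, Rinv_l by lra. lra. }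
    apply Rmult_lt_compat_r with (r := K + 1) in HN; [|lra].
    unfold Rdiv in HN. rewrite Rmult_assoc, Rinv_l in HN by lra.
    assert (0 <= (/ 2) ^ N) by (apply pow_le; lra). nra.
  - right.
    assert (exists N, a N <> 0 /\ forall j, (j < N)%nat -> a j = 0) as (N & HN & Hlow).
    { apply not_all_ex_not in NZ. destruct NZ as [n Hn]. revert Hn.
      induction n as [n IH] using lt_wf_ind. intros Hn.
      destruct (classic (exists j, (j < n)%nat /\ a j <> 0)) as [(j & Hj & Hj')|Hno].
      - apply (IH j Hj Hj').
      - exists n. split; auto. intros j Hj. apply NNPP. intros Hj'. apply Hno. eauto. }
    apply Cmod_gt_0 in HN. set (A := Cmod (a N)) in *.
    assert (Hrp : 0 < r ^ S N) by now apply pow_lt.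
    set (K' := K / r ^ S N).
    assert (HK' : 0 <= K') by now apply Rdiv_le_0_compat.
    assert (HA : 0 < A / (K' + 1)) by (apply Rdiv_lt_0_compat; lra).
    exists (Rmin (r / 2) (A / (K' + 1))). split. apply Rmin_pos; lra.
    intros w [Hw0 Hw] E. pose proof (Rmin_l (r / 2) (A / (K' + 1))).
    pose proof (Rmin_r (r / 2) (A / (K' + 1))).
    specialize (T (S N) w ltac:(lra)). simpl poly_sum in T. rewrite Hps, E in T by auto.
    replace (0 - (0 + a N * (w - p) ^ N))%C with (- (a N * (w - p) ^ N))%C in T by ring.
    rewrite Cmod_opp, Cmod_mult, Cmod_pow in T. fold A in T.
    unfold Rdiv in T. rewrite Rpow_mult_distr, pow_inv in T.
    replace (K * (Cmod (w - p) ^ S N * / r ^ S N)) with (K' * (Cmod (w - p) * Cmod (w - p) ^ N)) in T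
      by (unfold K', Rdiv; simpl; ring).
    assert (0 < Cmod (w - p) ^ N) by now apply pow_lt.
    rewrite <- Rmult_assoc in T. apply Rmult_le_reg_r in T; auto.
    assert (Cmod (w - p) * (K' + 1) < A).
    { replace A with (A / (K' + 1) * (K' + 1)) by (field; lra). apply Rmult_lt_compat_r; lra. }
    nra.
Qed.

(** [(z - p) * k z] is differentiable at [p] as well, with derivative [k p], so it has
    a Taylor expansion; dividing that expansion of order three by [z - p] gives an
    expansion of [k] with quadratic error. *)
Lemma removable k p d : 0 < d -> ccont k p ->
  (forall z, 0 < Cmod (z - p) < d -> cdiff k z) -> cdiff k p.
Proof.
  intros Hd Hc Hk.
  destruct (ccont_bounded _ _ Hc) as (d1 & P1 & Hb).
  set (r := Rmin d d1 / 4).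
  pose proof (Rmin_l d d1). pose proof (Rmin_r d d1).
  assert (Hr : 0 < r). { assert (0 < Rmin d d1) by now apply Rmin_pos. unfold r; lra. }
  set (m := fun z => ((z - p) * k z)%C).
  assert (Hm : cauchy_rep m p r).
  { apply (holomorphic_cauchy_rep _ _ _ (2 * r * (Cmod (k p) + 1))); auto. intros z Hz. split.
    - destruct (Ceq_decide z p) as [->|n].
      + exists (k p). exists k. split; [|split]; auto. intros y. unfold m. ring.
      + pose proof (Cmod_sub_pos _ _ n). destruct (Hk z) as [l Hl]. unfold r in Hz; lra.
        eexists. apply (cderiv_mult (fun z => z + - p)%C k).
        exact (cderiv_plus _ _ _ _ _ (cderiv_id z) (cderiv_const (- p)%C z)). exact Hl.
    - unfold m. rewrite Cmod_mult. apply Rmult_le_compat; auto using Cmod_ge_0.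
      apply Hb. unfold r in Hz; lra. }
  destruct (cauchy_rep_taylor _ _ _ Hm) as (a & K & HK & T).
  assert (Ea0 : a 0%nat = 0).
  { rewrite <- (taylor_at_center _ _ _ _ _ Hr T). unfold m. ring. }
  set (K' := K / (r * r * r)).
  assert (HK' : 0 <= K') by (apply Rdiv_le_0_compat; auto; apply Rmult_lt_0_compat; [apply Rmult_lt_0_compat|]; exact Hr).
  assert (Hq : forall w, w <> p -> Cmod (w - p) <= r / 2 ->
     Cmod (k w - a 1%nat - a 2%nat * (w - p)) <= K' * (Cmod (w - p) * Cmod (w - p))).
  { intros w Hw Hwr. pose proof (Cmod_sub_pos _ _ Hw) as Hpos.
    specialize (T 3%nat w Hwr). simpl in T. rewrite Ea0 in T. unfold m in T.
    replace ((w - p) * k w - (0 + 0 * 1 + a 1%nat * ((w - p) * 1) + a 2%nat * ((w - p) * ((w - p) * 1))))%C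
      with ((k w - a 1%nat - a 2%nat * (w - p)) * (w - p))%C in T by ring.
    rewrite Cmod_mult in T. apply Rmult_le_reg_r with (Cmod (w - p)); auto.
    eapply Rle_trans. apply T. right. unfold K'. field. lra. }
  (* The expansion holds off p and k is continuous at p, so its constant term is k p. *)
  assert (E1 : k p = a 1%nat).
  { apply NNPP. intros Hne. pose proof (Cmod_sub_pos _ _ Hne) as Hpos.
    set (e := Cmod (k p - a 1%nat)) in *.
    destruct (Hc (e / 4)) as (d2 & P2 & H2). lra.
    set (B := Cmod (a 2%nat) + K' * r + 1).
    pose proof (Cmod_ge_0 (a 2%nat)). assert (0 <= K' * r) by nra.
    assert (HB : 0 < e / (4 * B)) by (apply Rdiv_lt_0_compat; unfold B; lra).
    set (s := Rmin (Rmin (d2 / 2) (r / 2)) (e / (4 * B))).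
    assert (Hs : 0 < s) by (repeat apply Rmin_pos; lra).
    assert (Hs1 : s <= d2 / 2 /\ s <= r / 2 /\ s <= e / (4 * B)).
    { pose proof (Rmin_l (Rmin (d2 / 2) (r / 2)) (e / (4 * B))).
      pose proof (Rmin_r (Rmin (d2 / 2) (r / 2)) (e / (4 * B))).
      pose proof (Rmin_l (d2 / 2) (r / 2)). pose proof (Rmin_r (d2 / 2) (r / 2)).
      unfold s; lra. }
    set (w := (p + RtoC s)%C).
    assert (Ew : (w - p)%C = RtoC s) by (unfold w; ring).
    assert (Hws : Cmod (w - p) = s) by (rewrite Ew, Cmod_R, Rabs_right; lra).
    assert (Hwp : w <> p) by (apply Cmod_sub_neq; lra).
    specialize (Hq w Hwp ltac:(lra)). specialize (H2 w ltac:(lra)). rewrite Hws in Hq.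
    assert (Htri : e <= Cmod (k w - k p) + (Cmod (k w - a 1%nat - a 2%nat * (w - p)) + Cmod (a 2%nat * (w - p)))).
    { unfold e. rewrite <- (Cmod_opp (k w - k p)).
      eapply Rle_trans; [|apply Rplus_le_compat_l, Cmod_triangle].
      eapply Rle_trans; [|apply Cmod_triangle]. right. f_equal. ring. }
    rewrite Cmod_mult, Hws in Htri.
    assert (s * (4 * B) <= e).
    { replace e with (e / (4 * B) * (4 * B)) by (field; unfold B; lra).
      apply Rmult_le_compat_r; unfold B in *; lra. }
    assert (K' * (s * s) <= K' * r * s).
    { rewrite Rmult_assoc. apply Rmult_le_compat_l; auto. apply Rmult_le_compat_r; lra. }
    unfold B in *. lra. }
  exists (a 2%nat). apply (quadratic_error_cderiv k p _ K' (r / 2)). lra.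
  intros w Hw. destruct (Ceq_decide w p) as [->|n].
  - rewrite Cmod_sub_refl. replace (k p - k p - a 2%nat * (p - p))%C with (RtoC 0) by ring.
    rewrite Cmod_0. lra.
  - rewrite E1. apply Hq; auto. lra.
Qed.

(** * The chordal metric and inversion of the sphere *)

(** Inverse stereographic projection onto the unit sphere of [C * R]. *)
Definition stereo (p : Cbar) : C * R :=
  match p with
  | CFin z => ((RtoC (2 / (1 + Cmod z ^ 2)) * z)%C, (Cmod z ^ 2 - 1) / (1 + Cmod z ^ 2))
  | CInfty => (RtoC 0, 1)
  end.

Definition norm3 (u : C) (t : R) : R := Cmod (Cmod u, t).

Lemma norm3_triangle u v s t : norm3 (u + v) (s + t) <= norm3 u s + norm3 v t.
Proof.
  unfold norm3. eapply Rle_trans; [|apply (Cmod_triangle (Cmod u, s) (Cmod v, t))].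
  unfold Cmod at 1 3; simpl. apply sqrt_le_1_alt.
  pose proof (Cmod_triangle u v). pose proof (Cmod_ge_0 (u + v)).
  apply Rplus_le_compat_r. rewrite !Rmult_1_r. apply Rmult_le_compat; auto.
Qed.

Lemma sqrt_1_Cmod_sqr z : sqrt (1 + Cmod z ^ 2) * sqrt (1 + Cmod z ^ 2) = 1 + Cmod z ^ 2.
Proof. apply sqrt_sqrt. pose proof (pow2_ge_0 (Cmod z)). lra. Qed.

Lemma sqrt_1_Cmod_pos z : 1 <= sqrt (1 + Cmod z ^ 2).
Proof.
  rewrite <- sqrt_1 at 1. apply sqrt_le_1_alt. pose proof (pow2_ge_0 (Cmod z)). lra.
Qed.

Lemma Cmod_sqr z : Cmod z ^ 2 = Re z ^ 2 + Im z ^ 2.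
Proof. apply Cmod2_alt. Qed.

Lemma rho_ge_0 p q : 0 <= rho p q.
Proof.
  destruct p as [z|], q as [w|]; simpl; try lra.
  - pose proof (sqrt_1_Cmod_pos z). pose proof (sqrt_1_Cmod_pos w).
    apply Rdiv_le_0_compat. pose proof (Cmod_ge_0 (z - w)). lra. simpl in *. nra.
  - pose proof (sqrt_1_Cmod_pos z). apply Rdiv_le_0_compat; simpl in *; lra.
  - pose proof (sqrt_1_Cmod_pos w). apply Rdiv_le_0_compat; simpl in *; lra.
Qed.

Lemma rho_stereo p q :
  rho p q = norm3 (fst (stereo p) - fst (stereo q)) (snd (stereo p) - snd (stereo q)).
Proof.
  apply Rsqr_inj. apply rho_ge_0. apply Cmod_ge_0. unfold Rsqr, norm3.
  match goal with |- _ = Cmod ?a * Cmod ?a => transitivity (Cmod a ^ 2); [|ring] end.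
  rewrite (Cmod_sqr (Cmod _, _)). unfold Re at 1, Im at 1; cbn [fst snd].
  rewrite Cmod_sqr.
  destruct p as [z|], q as [w|]; unfold rho; cbn [stereo fst snd].
  - pose proof (sqrt_1_Cmod_pos z) as P1. pose proof (sqrt_1_Cmod_pos w) as P2.
    pose proof (sqrt_1_Cmod_sqr z) as S1. pose proof (sqrt_1_Cmod_sqr w) as S2.
    set (a := sqrt (1 + Cmod z ^ 2)) in *. set (b := sqrt (1 + Cmod w ^ 2)) in *.
    transitivity (4 * Cmod (z - w) ^ 2 / ((a * a) * (b * b))). field; lra.
    rewrite S1, S2, !Cmod_sqr. destruct z as [x y], w as [x' y']. unfold Re, Im; simpl.
    field. split; nra.
  - pose proof (sqrt_1_Cmod_pos z) as P1. pose proof (sqrt_1_Cmod_sqr z) as S1.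
    set (a := sqrt (1 + Cmod z ^ 2)) in *.
    transitivity (4 / (a * a)). field; lra.
    rewrite S1, !Cmod_sqr. destruct z as [x y]. unfold Re, Im; simpl. field. nra.
  - pose proof (sqrt_1_Cmod_pos w) as P1. pose proof (sqrt_1_Cmod_sqr w) as S1.
    set (a := sqrt (1 + Cmod w ^ 2)) in *.
    transitivity (4 / (a * a)). field; lra.
    rewrite S1, !Cmod_sqr. destruct w as [x y]. unfold Re, Im; simpl. field. nra.
  - unfold Re, Im; simpl. ring.
Qed.

Lemma rho_triangle p q s : rho p s <= rho p q + rho q s.
Proof.
  rewrite !rho_stereo. eapply Rle_trans; [|apply norm3_triangle]. right. f_equal; ring.
Qed.

Lemma rho_sym p q : rho p q = rho q p.
Proof.
  rewrite !rho_stereo. unfold norm3. rewrite Cmod_sub_sym. unfold Cmod at 1 3; simpl.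
  f_equal. ring.
Qed.

Lemma rho_refl p : rho p p = 0.
Proof.
  rewrite rho_stereo. unfold norm3. rewrite Cmod_sub_refl. unfold Rminus. rewrite Rplus_opp_r.
  apply Cmod_0.
Qed.

Lemma rho_triangle3 p q s t : rho p t <= rho p q + rho q s + rho s t.
Proof. pose proof (rho_triangle p q t). pose proof (rho_triangle q s t). lra. Qed.

(** The junk value [0] at infinity agrees with the convention [/ 0 = 0], so that
    [fin_part_Cbar_inv] holds for every [z]. *)
Definition fin_part (p : Cbar) : C := match p with CFin z => z | CInfty => RtoC 0 end.

Definition Cbar_inv (p : Cbar) : Cbar :=
  match p with
  | CFin z => if Ceq_decide z 0 then CInfty else CFin (/ z)%C
  | CInfty => CFin 0
  end.

Lemma Cinv_0 : (/ 0)%C = 0.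
Proof. apply injective_projections; simpl; unfold Rdiv; ring. Qed.

Lemma fin_part_Cbar_inv z : fin_part (Cbar_inv (CFin z)) = (/ z)%C.
Proof. simpl. destruct (Ceq_decide z 0) as [->|n]; simpl; auto. now rewrite Cinv_0. Qed.

Lemma Cinv_neq_0 (z : C) : z <> 0 -> (/ z)%C <> 0.
Proof. intros H E. apply C1_nz. rewrite <- (Cinv_r z H), E. ring. Qed.

Lemma Cinv_inv (z : C) : z <> 0 -> (/ / z)%C = z.
Proof. intros. field. auto. Qed.

Lemma Cbar_inv_involutive p : Cbar_inv (Cbar_inv p) = p.
Proof.
  destruct p as [z|]; simpl.
  - destruct (Ceq_decide z 0) as [->|n]; simpl; auto.
    destruct (Ceq_decide (/ z)%C 0) as [E|_]. now apply Cinv_neq_0 in E.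
    now rewrite Cinv_inv.
  - destruct (Ceq_decide 0 0); congruence.
Qed.

(** Inversion is a half-turn of the sphere about the real axis. *)
Lemma stereo_Cbar_inv p : stereo (Cbar_inv p) = (Cconj (fst (stereo p)), - snd (stereo p)).
Proof.
  destruct p as [z|]; cbn [Cbar_inv].
  - destruct (Ceq_decide z 0) as [->|n]; cbn [stereo fst snd].
    + rewrite Cmod_0. apply injective_projections; simpl; [|field].
      apply injective_projections; simpl; ring.
    + assert (Hz : 0 < Cmod z ^ 2) by (apply pow_lt, Cmod_gt_0; auto).
      rewrite Cmod_inv by auto. rewrite pow_inv. rewrite Cmod_sqr in *.
      destruct z as [x y]. unfold Re, Im in *; cbn [fst snd] in *.
      repeat apply injective_projections; simpl in *; field; nra.
  - simpl. rewrite Cmod_0. apply injective_projections; simpl; [|field].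
    apply injective_projections; simpl; ring.
Qed.

Lemma rho_Cbar_inv p q : rho (Cbar_inv p) (Cbar_inv q) = rho p q.
Proof.
  rewrite !rho_stereo, !stereo_Cbar_inv. cbn [fst snd]. unfold norm3.
  replace (Cconj (fst (stereo p)) - Cconj (fst (stereo q)))%C
    with (Cconj (fst (stereo p) - fst (stereo q))).
  2:{ apply injective_projections; simpl; ring. }
  rewrite Cmod_conj. unfold Cmod at 1 3; simpl. f_equal. ring.
Qed.

Lemma rho_fin_le z w : rho (CFin z) (CFin w) <= 2 * Cmod (z - w).
Proof.
  unfold rho. pose proof (sqrt_1_Cmod_pos z) as P1. pose proof (sqrt_1_Cmod_pos w) as P2.
  set (a := sqrt (1 + Cmod z ^ 2)) in *. set (b := sqrt (1 + Cmod w ^ 2)) in *.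
  pose proof (Cmod_ge_0 (z - w)). assert (1 <= a * b) by nra.
  apply Rmult_le_reg_r with (a * b). lra. unfold Rdiv. rewrite Rmult_assoc, Rinv_l by lra. nra.
Qed.

Lemma rho_infty_lower p d : 0 < d -> d <= rho p CInfty ->
  exists z, p = CFin z /\ sqrt (1 + Cmod z ^ 2) <= 2 / d.
Proof.
  intros Hd H. destruct p as [z|]; [|simpl in H; lra].
  exists z. split; auto. unfold rho in H. pose proof (sqrt_1_Cmod_pos z).
  set (a := sqrt _) in *. apply Rmult_le_reg_r with d; auto.
  replace (2 / d * d) with 2 by (field; lra).
  apply Rmult_le_compat_r with (r := a) in H; [|lra].
  replace (2 / a * a) with 2 in H by (field; lra). lra.
Qed.

Lemma Cmod_le_sqrt_1 z : Cmod z <= sqrt (1 + Cmod z ^ 2).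
Proof.
  apply Rsqr_incr_0_var. unfold Rsqr. rewrite sqrt_1_Cmod_sqr. simpl. lra. apply sqrt_pos.
Qed.

Lemma fin_part_bound p d : 0 < d -> d <= rho p CInfty -> Cmod (fin_part p) <= 2 / d.
Proof.
  intros Hd H. destruct (rho_infty_lower p d Hd H) as (z & -> & Hz). simpl fin_part.
  eapply Rle_trans. apply Cmod_le_sqrt_1. auto.
Qed.

(** Away from infinity the chordal distance controls the Euclidean one; this turns
    spherical uniform convergence into ordinary uniform convergence. *)
Lemma fin_part_dist p q d : 0 < d -> d <= rho p CInfty -> d <= rho q CInfty ->
  Cmod (fin_part p - fin_part q) <= rho p q * (2 / (d * d)).
Proof.
  intros Hd Hp Hq. destruct (rho_infty_lower p d Hd Hp) as (z & -> & Hz).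
  destruct (rho_infty_lower q d Hd Hq) as (w & -> & Hw). simpl fin_part. unfold rho.
  pose proof (sqrt_1_Cmod_pos z). pose proof (sqrt_1_Cmod_pos w).
  set (a := sqrt (1 + Cmod z ^ 2)) in *. set (b := sqrt (1 + Cmod w ^ 2)) in *.
  pose proof (Cmod_ge_0 (z - w)).
  assert (a * b <= 2 / d * (2 / d)) by (apply Rmult_le_compat; lra).
  replace (2 * Cmod (z - w) / (a * b) * (2 / (d * d))) with
     (Cmod (z - w) * ((2 / d * (2 / d)) / (a * b))) by (field; lra).
  rewrite <- (Rmult_1_r (Cmod (z - w))) at 1. apply Rmult_le_compat_l; auto.
  assert (1 <= a * b) by nra.
  apply Rmult_le_reg_r with (a * b). lra. unfold Rdiv at 1. rewrite Rmult_assoc, Rinv_l by lra. lra.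
Qed.

Lemma rho_fin_infty_pos p : p <> CInfty -> 0 < rho p CInfty.
Proof.
  intros H. destruct p as [z|]; [|congruence]. unfold rho. pose proof (sqrt_1_Cmod_pos z).
  apply Rdiv_lt_0_compat; lra.
Qed.

(** * Holomorphic maps into the sphere and their limits *)

Definition sph_cont (f : C -> Cbar) (z : C) : Prop :=
  forall eps, 0 < eps -> exists delta, 0 < delta /\
    forall y, Cmod (y - z) < delta -> rho (f y) (f z) < eps.

(** Holomorphy in the two charts of the sphere.  It is symmetric under [Cbar_inv],
    and, unlike [meromorphic_on], it admits the constant infinity, so that it passes
    to uniform limits without exception. *)
Definition sph_hol (f : C -> Cbar) (z : C) : Prop :=
  sph_cont f z /\ (f z <> CInfty -> cdiff (fun y => fin_part (f y)) z) /\
  (f z <> CFin 0 -> cdiff (fun y => fin_part (Cbar_inv (f y))) z).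

Lemma sph_cont_Cbar_inv f z : sph_cont f z -> sph_cont (fun y => Cbar_inv (f y)) z.
Proof.
  intros H e He. destruct (H e He) as (d & P & Hd). exists d. split; auto.
  intros y Hy. rewrite rho_Cbar_inv. auto.
Qed.

Lemma Cbar_inv_neq_infty p : Cbar_inv p <> CInfty -> p <> CFin 0.
Proof. intros H ->. apply H. simpl. destruct (Ceq_decide 0 0); congruence. Qed.

Lemma Cbar_inv_neq_0 p : Cbar_inv p <> CFin 0 -> p <> CInfty.
Proof. intros H ->. now apply H. Qed.

Lemma cdiff_ext f g z : (forall y, f y = g y) -> cdiff f z -> cdiff g z.
Proof. intros E [l H]. exists l. apply (cderiv_eventually_eq f g z l 1); auto. lra. Qed.

Lemma sph_hol_Cbar_inv f z : sph_hol f z -> sph_hol (fun y => Cbar_inv (f y)) z.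
Proof.
  intros (H1 & H2 & H3). split; [|split].
  - now apply sph_cont_Cbar_inv.
  - intros H. apply H3. now apply Cbar_inv_neq_infty.
  - intros H. apply (cdiff_ext (fun y => fin_part (f y))).
    intros; now rewrite Cbar_inv_involutive. apply H2. now apply Cbar_inv_neq_0.
Qed.

Lemma sph_cont_away_infty f z : sph_cont f z -> f z <> CInfty -> exists d m, 0 < d /\ 0 < m /\
  forall y, Cmod (y - z) < d -> m <= rho (f y) CInfty.
Proof.
  intros Hs Hf. apply rho_fin_infty_pos in Hf. set (m := rho (f z) CInfty) in *.
  destruct (Hs (m / 2)) as (d & P & Hd). lra.
  exists d, (m / 2). split; [|split]; auto. lra.
  intros y Hy. specialize (Hd y Hy). pose proof (rho_triangle (f z) (f y) CInfty).
  rewrite rho_sym in Hd. fold m in H. lra.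
Qed.

Lemma away_infty_neq p m : 0 < m -> m <= rho p CInfty -> p <> CInfty.
Proof. intros H1 H2 ->. rewrite rho_refl in H2. lra. Qed.

Lemma sph_cont_fin_part f z : sph_cont f z -> f z <> CInfty -> ccont (fun y => fin_part (f y)) z.
Proof.
  intros Hs Hf. destruct (sph_cont_away_infty f z Hs Hf) as (d & m & Pd & Pm & Ha).
  intros e He.
  destruct (Hs (e / (2 / (m * m)))) as (d2 & P2 & H2).
  { repeat apply Rdiv_lt_0_compat; try apply Rmult_lt_0_compat; lra. }
  exists (Rmin d d2). split. now apply Rmin_pos. intros y Hy.
  pose proof (Rmin_l d d2). pose proof (Rmin_r d d2).
  eapply Rle_lt_trans. apply (fin_part_dist _ _ m); auto. apply Ha; lra.
  apply Ha. rewrite Cmod_sub_refl; lra.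
  assert (0 < 2 / (m * m)) by (apply Rdiv_lt_0_compat; [|apply Rmult_lt_0_compat]; lra).
  replace e with (e / (2 / (m * m)) * (2 / (m * m))) by (field; lra).
  apply Rmult_lt_compat_r; auto. apply H2. lra.
Qed.

Definition local_limit (fn : nat -> C -> Cbar) (f : C -> Cbar) (z0 : C) (d : R) : Prop :=
  0 < d /\ (forall n z, Cmod (z - z0) < d -> sph_hol (fn n) z) /\
  forall eps, 0 < eps -> exists n, forall z, Cmod (z - z0) < d -> rho (fn n z) (f z) < eps.

Lemma sph_cont_limit fn f z0 d : local_limit fn f z0 d ->
  forall z, Cmod (z - z0) < d -> sph_cont f z.
Proof.
  intros (Hd & Hh & Hl) z Hz e He. destruct (Hl (e / 3)) as [n Hn]. lra.
  destruct (Hh n z Hz) as (Hs & _). destruct (Hs (e / 3)) as (d1 & P1 & H1). lra.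
  exists (Rmin d1 (d - Cmod (z - z0))). split. apply Rmin_pos; lra.
  intros y Hy. pose proof (Rmin_l d1 (d - Cmod (z - z0))).
  pose proof (Rmin_r d1 (d - Cmod (z - z0))).
  pose proof (rho_triangle3 (f y) (fn n y) (fn n z) (f z)).
  pose proof (Cmod_sub_triangle y z z0).
  specialize (H1 y ltac:(lra)). pose proof (Hn y ltac:(lra)) as N1. pose proof (Hn z Hz) as N2.
  rewrite rho_sym in N1. lra.
Qed.

(** Near [z0] the limit has chordal distance at least [m] from infinity, and the
    approximants at least [m/2]; their finite parts are then bounded holomorphic
    functions converging uniformly, and [cauchy_rep_limit] applies. *)
Lemma finite_limit_cdiff fn f z0 d : local_limit fn f z0 d -> f z0 <> CInfty ->
  cdiff (fun y => fin_part (f y)) z0.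
Proof.
  intros HL Hf. pose proof (sph_cont_limit _ _ _ _ HL) as Hsc. destruct HL as (Hd & Hh & Hl).
  destruct (sph_cont_away_infty f z0) as (d1 & m & P1 & Pm & Ha); auto.
  { apply Hsc. rewrite Cmod_sub_refl; auto. }
  set (r := Rmin d d1 / 4). pose proof (Rmin_l d d1). pose proof (Rmin_r d d1).
  assert (Hr : 0 < r). { assert (0 < Rmin d d1) by now apply Rmin_pos. unfold r; lra. }
  assert (Hin : forall z, Cmod (z - z0) <= 2 * r -> Cmod (z - z0) < d /\ m <= rho (f z) CInfty).
  { intros z Hz. unfold r in Hz. split. lra. apply Ha. lra. }
  assert (Hsq : forall z, on_sq z0 r z -> Cmod (z - z0) <= 2 * r) by (intros z Hz; apply on_sq_bounds in Hz; lra).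
  apply (cauchy_rep_cdiff _ _ r).
  apply (cauchy_rep_limit (fun n z => fin_part (fn n z))); auto.
  - intros z Hz. apply sph_cont_fin_part. apply Hsc. apply Hin; auto.
    apply (away_infty_neq _ m); auto. apply Hin; auto.
  - exists (2 / m). intros z Hz. apply fin_part_bound; auto. apply Hin; auto.
  - intros e He.
    assert (HA : 0 < 2 / (m / 2 * (m / 2))) by (apply Rdiv_lt_0_compat; [|apply Rmult_lt_0_compat]; lra).
    destruct (Hl (Rmin (m / 2) (e / (2 / (m / 2 * (m / 2)))))) as [n Hn].
    { apply Rmin_pos. lra. now apply Rdiv_lt_0_compat. }
    pose proof (Rmin_l (m / 2) (e / (2 / (m / 2 * (m / 2))))).
    pose proof (Rmin_r (m / 2) (e / (2 / (m / 2 * (m / 2))))).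
    assert (Hfar : forall z, Cmod (z - z0) <= 2 * r -> m / 2 <= rho (fn n z) CInfty).
    { intros z Hz. destruct (Hin z Hz) as [I1 I2]. specialize (Hn z I1).
      pose proof (rho_triangle (f z) (fn n z) CInfty) as Ht.
      rewrite (rho_sym (f z) (fn n z)) in Ht. lra. }
    exists n. split.
    + apply (holomorphic_cauchy_rep _ _ _ (2 / (m / 2))); auto. intros z Hz. split.
      * destruct (Hh n z) as (_ & H3 & _). apply Hin; auto. apply H3.
        apply (away_infty_neq _ (m / 2)); auto. lra.
      * apply fin_part_bound; auto. lra.
    + intros z Hz. destruct (Hin z Hz) as [I1 I2]. specialize (Hn z I1).
      eapply Rle_trans. apply (fin_part_dist _ _ (m / 2)); auto; lra.
      set (A := 2 / (m / 2 * (m / 2))) in *.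
      apply Rle_trans with (e / A * A). apply Rmult_le_compat_r; lra. right; field; lra.
Qed.

Lemma sph_hol_limit fn f z0 d : local_limit fn f z0 d -> sph_hol f z0.
Proof.
  intros HL. split; [|split].
  - apply (sph_cont_limit _ _ _ _ HL). rewrite Cmod_sub_refl. apply HL.
  - now apply (finite_limit_cdiff fn f z0 d).
  - intros H. apply (finite_limit_cdiff (fun n z => Cbar_inv (fn n z)) (fun z => Cbar_inv (f z)) z0 d).
    + destruct HL as (Hd & Hh & Hl). split; [|split]; auto.
      * intros. apply sph_hol_Cbar_inv; auto.
      * intros e He. destruct (Hl e He) as [n Hn]. exists n. intros. rewrite rho_Cbar_inv. auto.
    + intros E. apply H. rewrite <- (Cbar_inv_involutive (f z0)), E. reflexivity.
Qed.

(** Both sides say the same thing in terms of [Cmod]; the balls of the absolute ring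
    of complex numbers are discs. *)
Lemma ex_derive_cdiff g z : @ex_derive C_AbsRing C_NormedModule g z <-> cdiff g z.
Proof.
  split.
  - intros [l [_ Hl]]. exists l. apply cderiv_eps. intros e He.
    destruct (Hl z (fun P H => H) (mkposreal e He)) as [d Hd].
    exists d. split. apply cond_pos. intros y Hy. specialize (Hd y Hy).
    replace (l * (y - z))%C with ((y - z) * l)%C by ring. exact Hd.
  - intros [l Hl]. exists l. rewrite cderiv_eps in Hl. split.
    apply is_linear_scal_l.
    intros x Hx e.
    apply (@is_filter_lim_locally_unique C_AbsRing (AbsRing_NormedModule C_AbsRing)) in Hx. subst x.
    destruct (Hl e (cond_pos e)) as (d & P & Hd). exists (mkposreal d P). intros y Hy.
    specialize (Hd y Hy). replace (l * (y - z))%C with ((y - z) * l)%C in Hd by ring. exact Hd.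
Qed.

(** The neighbourhoods in [C_UniformSpace] are squares, hence the halved radius in
    one direction. *)
Lemma filterlim_Cmod_infty (g : C -> C) (z0 : C) :
  filterlim (fun z : C => Cmod (g z)) (@locally' C_UniformSpace z0) (Rbar_locally p_infty) <->
  forall M, exists delta, 0 < delta /\
    forall y, 0 < Cmod (y - z0) < delta -> M < Cmod (g y).
Proof.
  split.
  - intros H M. destruct (H (fun x => M < x)) as [d Hd].
    { exists M. auto. }
    exists d. split. apply cond_pos. intros y [Hy1 Hy2]. apply (Hd y).
    + split. eapply Rle_lt_trans; [apply (re_le_Cmod (y - z0))|auto].
      eapply Rle_lt_trans; [apply (im_le_Cmod (y - z0))|auto].
    + now apply Cmod_sub_neq.
  - intros H P [M HM]. destruct (H M) as (d & Pd & Hd).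
    assert (Pd2 : 0 < d / 2) by lra.
    exists (mkposreal _ Pd2). intros y [Hy1 Hy2] Hne. apply HM, Hd. split.
    now apply Cmod_sub_pos. eapply Rle_lt_trans. apply Cmod_le_Re_Im.
    change (Rabs (Re (y - z0)) < d / 2) in Hy1. change (Rabs (Im (y - z0)) < d / 2) in Hy2. lra.
Qed.

(** At a pole of [f] the function [1/f] extends continuously by [0] and is
    differentiable around, so [removable] applies. *)
Lemma meromorphic_sph_hol D f z0 : meromorphic_on D f -> D z0 -> sph_hol f z0.
Proof.
  intros Hm HD. destruct (Hm z0 HD) as (g & r & Hg & Hz0). pose proof (cond_pos r) as Pr.
  destruct (f z0) as [w|] eqn:E.
  - destruct Hz0 as [-> Hd]. apply ex_derive_cdiff in Hd.
    assert (Hfg : forall y, Cmod (y - z0) < r -> f y = CFin (g y)).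
    { intros y Hy. destruct (Ceq_decide y z0) as [->|n]; auto.
      apply Hg. split; auto. now apply Cmod_sub_pos. }
    destruct Hd as [l Hl]. split; [|split].
    + intros e He. destruct (cderiv_ccont _ _ _ Hl (e / 2)) as (d & P & Hd). lra.
      exists (Rmin d r). split. now apply Rmin_pos. intros y Hy.
      pose proof (Rmin_l d r). pose proof (Rmin_r d r).
      rewrite E, (Hfg y) by lra. eapply Rle_lt_trans. apply rho_fin_le.
      specialize (Hd y ltac:(lra)). lra.
    + intros _. exists l. apply (cderiv_eventually_eq g _ _ _ r); auto.
      intros y Hy. now rewrite Hfg.
    + intros H. rewrite E in H. eexists. apply (cderiv_eventually_eq (fun y => / g y)%C _ _ _ r); auto.
      intros y Hy. now rewrite Hfg, fin_part_Cbar_inv.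
      apply cderiv_inv. exact Hl. congruence.
  - rewrite filterlim_Cmod_infty in Hz0.
    assert (Hu0 : fin_part (Cbar_inv (f z0)) = 0) by now rewrite E.
    assert (Huy : forall y, 0 < Cmod (y - z0) < r -> fin_part (Cbar_inv (f y)) = (/ g y)%C).
    { intros y Hy. destruct (Hg y Hy) as [-> _]. apply fin_part_Cbar_inv. }
    split; [|split].
    + intros e He. destruct (Hz0 (2 / e)) as (d & P & Hd).
      exists (Rmin d r). split. now apply Rmin_pos. intros y Hy.
      pose proof (Rmin_l d r). pose proof (Rmin_r d r). rewrite E.
      destruct (Ceq_decide y z0) as [->|n]. rewrite E, rho_refl; auto.
      apply Cmod_sub_pos in n. destruct (Hg y ltac:(lra)) as [-> _].
      specialize (Hd y ltac:(lra)). pose proof (Cmod_le_sqrt_1 (g y)).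
      pose proof (sqrt_1_Cmod_pos (g y)).
      unfold rho. set (a := sqrt _) in *. apply Rmult_lt_reg_r with a. lra.
      replace (2 / a * a) with 2 by (field; lra).
      assert (2 / e < a) by lra. apply Rmult_lt_compat_r with (r := e) in H3; auto.
      replace (2 / e * e) with 2 in H3 by (field; lra). lra.
    + congruence.
    + intros _. destruct (Hz0 1) as (d1 & P1 & Hd1).
      apply (removable _ _ (Rmin d1 r)). now apply Rmin_pos.
      * intros e He. destruct (Hz0 (/ e)) as (d & P & Hd).
        exists (Rmin d r). split. now apply Rmin_pos. intros y Hy.
        pose proof (Rmin_l d r). pose proof (Rmin_r d r).
        destruct (Ceq_decide y z0) as [->|n]. rewrite Cmod_sub_refl; auto.
        apply Cmod_sub_pos in n. rewrite Hu0, Huy by lra.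
        specialize (Hd y ltac:(lra)).
        assert (0 < / e) by now apply Rinv_0_lt_compat.
        assert (g y <> 0) by (apply Cmod_gt_0; lra).
        replace (/ g y - 0)%C with (/ g y)%C by ring. rewrite Cmod_inv by auto.
        rewrite <- (Rinv_inv e). apply Rinv_lt_contravar; auto. apply Rmult_lt_0_compat; lra.
      * intros z Hz. pose proof (Rmin_l d1 r). pose proof (Rmin_r d1 r).
        assert (Hgz : g z <> 0).
        { apply Cmod_gt_0. specialize (Hd1 z ltac:(lra)). lra. }
        destruct (Hg z ltac:(lra)) as [_ Hd]. apply ex_derive_cdiff in Hd. destruct Hd as [l Hl].
        eexists. apply (cderiv_eventually_eq (fun y => / g y)%C _ _ _
          (Rmin (Cmod (z - z0)) (r - Cmod (z - z0)))).
        apply Rmin_pos; lra.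
        2:{ apply cderiv_inv. exact Hl. auto. }
        intros y Hy. rewrite Huy; auto.
        pose proof (Rmin_l (Cmod (z - z0)) (r - Cmod (z - z0))).
        pose proof (Rmin_r (Cmod (z - z0)) (r - Cmod (z - z0))).
        pose proof (Cmod_sub_triangle y z z0). pose proof (Cmod_sub_triangle z y z0).
        rewrite (Cmod_sub_sym z y) in H4. lra.
Qed.

(** * The set where a limit is infinite *)

Definition near_infty (f : C -> Cbar) (z : C) : Prop :=
  exists d, 0 < d /\ forall y, Cmod (y - z) < d -> f y = CInfty.

(** Where [f] is infinite, [1/f] has a zero, which is either isolated or interior to
    the zero set. *)
Lemma infty_dichotomy f z0 d : 0 < d -> (forall z, Cmod (z - z0) < d -> sph_hol f z) ->
  f z0 = CInfty ->
  near_infty f z0 \/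
  exists e, 0 < e /\ forall z, 0 < Cmod (z - z0) < e -> f z <> CInfty.
Proof.
  intros Hd Hh E. set (k := fun z => fin_part (Cbar_inv (f z))).
  assert (Hs : sph_cont f z0). { apply Hh. rewrite Cmod_sub_refl; auto. }
  assert (Hn0 : exists d1, 0 < d1 /\ forall z, Cmod (z - z0) < d1 -> f z <> CFin 0).
  { destruct (Hs 2) as (d1 & P1 & H1). lra. exists d1. split; auto. intros z Hz F.
    specialize (H1 z Hz). rewrite E, F in H1. unfold rho in H1. rewrite Cmod_0 in H1.
    replace (1 + 0 ^ 2) with 1 in H1 by ring. rewrite sqrt_1 in H1. lra. }
  destruct Hn0 as (d1 & P1 & Hn0).
  assert (Hk : forall z, Cmod (z - z0) < d -> Cmod (z - z0) < d1 -> cdiff k z).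
  { intros. apply Hh; auto. }
  destruct (ccont_bounded k z0) as (d2 & P2 & Hb).
  { apply cdiff_ccont, Hk; rewrite Cmod_sub_refl; auto. }
  assert (Hz : forall z, Cmod (z - z0) < d1 -> (k z = 0 <-> f z = CInfty)).
  { intros z Hz. specialize (Hn0 z Hz). unfold k. destruct (f z) as [w|].
    - rewrite fin_part_Cbar_inv. split; [|discriminate]. intros F. apply Cinv_neq_0 in F. easy.
      congruence.
    - simpl. tauto. }
  set (r := Rmin d (Rmin d1 d2) / 4).
  assert (Hr : 0 < r).
  { assert (0 < Rmin d (Rmin d1 d2)) by (repeat apply Rmin_pos; auto). unfold r; lra. }
  assert (Hr4 : 4 * r <= d /\ 4 * r <= d1 /\ 4 * r <= d2).
  { pose proof (Rmin_l d (Rmin d1 d2)). pose proof (Rmin_r d (Rmin d1 d2)).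
    pose proof (Rmin_l d1 d2). pose proof (Rmin_r d1 d2). unfold r. lra. }
  assert (Hrep : cauchy_rep k z0 r).
  { apply (holomorphic_cauchy_rep _ _ _ (Cmod (k z0) + 1)); auto. intros z Hzr.
    split. apply Hk; lra. apply Hb; lra. }
  destruct (isolated_zeros _ _ _ Hrep) as [Z|(e & Pe & He)].
  - left. exists (r / 2). split. lra. intros y Hy. apply Hz. lra. apply Z. lra.
  - right. exists (Rmin e d1). split. now apply Rmin_pos. intros z Hzr F.
    pose proof (Rmin_l e d1). pose proof (Rmin_r e d1).
    apply Hz in F; [|lra]. apply (He z); auto. lra.
Qed.

(** A point of the strip has a disc inside some substrip, where the hypotheses of
    uniform convergence apply. *)
Lemma strip_open a b z0 : strip a b z0 ->
  exists alpha beta d, substrip alpha beta a b /\ 0 < d /\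
    forall z, Cmod (z - z0) < d -> strip alpha beta z /\ strip a b z.
Proof.
  intros [H1 H2].
  remember (Im z0) as y0 eqn:Ey.
  assert (exists alpha : R, Rbar_lt a alpha /\ alpha < y0) as (alpha & A1 & A2).
  { destruct a as [a| |]; simpl in *; try easy.
    exists ((a + y0) / 2). lra. exists (y0 - 1). split; auto; lra. }
  assert (exists beta : R, Rbar_lt beta b /\ y0 < beta) as (beta & B1 & B2).
  { destruct b as [b| |]; simpl in *; try easy.
    exists ((b + y0) / 2). lra. exists (y0 + 1). split; auto; lra. }
  subst y0.
  exists alpha, beta, (Rmin (Im z0 - alpha) (beta - Im z0)). split; [|split].
  - split; auto. split; auto. lra.
  - apply Rmin_pos; lra.
  - intros z Hz. pose proof (Rmin_l (Im z0 - alpha) (beta - Im z0)).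
    pose proof (Rmin_r (Im z0 - alpha) (beta - Im z0)).
    pose proof (im_le_Cmod (z - z0)) as Hi.
    change (Im (z - z0)) with (Im z - Im z0) in Hi.
    assert (Hab : Rabs (Im z - Im z0) < Rmin (Im z0 - alpha) (beta - Im z0)) by lra.
    apply Rabs_lt_between in Hab.
    assert (S : strip alpha beta z) by (split; simpl; lra).
    split; auto. destruct S as [S1 S2]. split.
    eapply Rbar_lt_trans; eauto. eapply Rbar_lt_trans; eauto.
Qed.

Lemma strip_convex a b z1 z2 t : strip a b z1 -> strip a b z2 -> 0 <= t <= 1 ->
  strip a b (z1 + RtoC t * (z2 - z1))%C.
Proof.
  intros [H1 H2] [H3 H4] Ht. unfold strip.
  replace (Im (z1 + RtoC t * (z2 - z1))%C) with (Im z1 + t * (Im z2 - Im z1))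
    by (unfold Im; simpl; ring).
  set (x := Im z1) in *. set (y := Im z2) in *.
  assert (Hm : Rmin x y <= x + t * (y - x) <= Rmax x y).
  { unfold Rmin, Rmax. destruct (Rle_dec x y); nra. }
  split.
  - apply (Rbar_lt_le_trans _ (Rmin x y)); [|apply Hm].
    unfold Rmin. destruct (Rle_dec x y); auto.
  - apply (Rbar_le_lt_trans _ (Rmax x y)); [apply Hm|].
    unfold Rmax. destruct (Rle_dec x y); auto.
Qed.

(** Along the segment from [z1] to [z] let [T] be the supremum of the parameters up
    to which [f] is infinite near every point.  By continuity [f] is infinite at [T],
    and by [infty_dichotomy] it is infinite near that point, since otherwise the point
    would be isolated; hence [T] cannot be smaller than [1]. *)
Lemma near_infty_spreads a b f z1 : (forall z, strip a b z -> sph_hol f z) ->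
  strip a b z1 -> near_infty f z1 -> forall z, strip a b z -> f z = CInfty.
Proof.
  intros Hh Hz1 Hn z2 Hz2.
  set (g := fun t : R => (z1 + RtoC t * (z2 - z1))%C).
  set (V := Cmod (z2 - z1)). pose proof (Cmod_ge_0 (z2 - z1)) as HV0. fold V in HV0.
  assert (Hg : forall t, 0 <= t <= 1 -> strip a b (g t)) by (intros; now apply strip_convex).
  assert (Hlip : forall s t, Cmod (g s - g t) = Rabs (s - t) * V).
  { intros s t. unfold g, V. rewrite <- Cmod_R, <- Cmod_mult. f_equal. rewrite RtoC_minus. ring. }
  assert (Hself : forall z, near_infty f z -> f z = CInfty).
  { intros z (d & P & H). apply H. rewrite Cmod_sub_refl; auto. }
  set (E := fun t => 0 <= t <= 1 /\ forall s, 0 <= s <= t -> near_infty f (g s)).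
  assert (E0 : E 0).
  { split. lra. intros s Hs. replace s with 0 by lra.
    replace (g 0) with z1 by (unfold g; ring). auto. }
  destruct (completeness E) as [T [HT1 HT2]].
  { exists 1. intros t [Ht _]. lra. }
  { exists 0. auto. }
  assert (HT : 0 <= T <= 1).
  { split. apply HT1; auto. apply HT2. intros t [Ht _]. lra. }
  assert (Happ : forall d, 0 < d -> exists t, E t /\ T - d < t <= T).
  { intros d Pd. apply NNPP. intros Hno. assert (T <= T - d); [|lra].
    apply HT2. intros t Ht. apply Rnot_lt_le. intros Hlt. apply Hno. exists t. split; auto. }
  assert (Hclose : forall d, 0 < d -> exists t, E t /\ t <= T /\ Cmod (g t - g T) < d).
  { intros d Pd. destruct (Happ (d / (V + 1))) as (t & Ht & Ht2).
    { apply Rdiv_lt_0_compat; lra. }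
    exists t. split; [|split]; auto. rewrite Hlip.
    assert (Rabs (t - T) < d / (V + 1)) by (apply Rabs_lt_between; lra).
    apply Rmult_lt_compat_r with (r := V + 1) in H; [|lra].
    replace (d / (V + 1) * (V + 1)) with d in H by (field; lra).
    pose proof (Rabs_pos (t - T)). nra. }
  assert (HnT : near_infty f (g T)).
  { assert (HfT : f (g T) = CInfty).
    { apply NNPP. intros Hne. destruct (sph_cont_away_infty f (g T)) as (d & m & Pd & Pm & Ha); auto.
      apply Hh, Hg; auto. destruct (Hclose d Pd) as (t & [Ht1 Ht2] & _ & Hc).
      apply (away_infty_neq (f (g t)) m); auto. apply Hself, Ht2. lra. }
    destruct (strip_open a b (g T)) as (al & be & d & _ & Pd & Hd). apply Hg; auto.
    destruct (infty_dichotomy f (g T) d) as [Y|(e & Pe & He)]; auto.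
    { intros z Hz. apply Hh, Hd; auto. }
    destruct (Hclose e Pe) as (t & [Ht1 Ht2] & _ & Hc).
    destruct (Ceq_decide (g t) (g T)) as [Eq|Ne].
    - rewrite <- Eq. apply Ht2. lra.
    - exfalso. apply (He (g t)). split; auto. now apply Cmod_sub_pos.
      apply Hself, Ht2. lra. }
  destruct (Req_dec T 1) as [->|HT3].
  - apply Hself in HnT. replace z2 with (g 1); auto. unfold g. ring.
  - exfalso. destruct HnT as (d & Pd & Hd).
    assert (Hdv : 0 < d / (V + 1)) by (apply Rdiv_lt_0_compat; lra).
    set (T' := Rmin 1 (T + d / (V + 1) / 2)).
    assert (HT' : T < T') by (apply Rmin_glb_lt; lra).
    assert (HT'2 : T' <= 1) by apply Rmin_l.
    assert (HT'3 : T' <= T + d / (V + 1) / 2) by apply Rmin_r.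
    assert (E T'); [|apply HT1 in H; lra].
    split. lra. intros s Hs. destruct (Rlt_le_dec s T) as [L|L].
    + destruct (Happ (T - s)) as (t & [Ht1 Ht2] & Ht3). lra. apply Ht2. lra.
    + assert (Hc : Cmod (g s - g T) < d).
      { rewrite Hlip. rewrite Rabs_right by lra.
        assert (s - T < d / (V + 1)) by lra.
        apply Rmult_lt_compat_r with (r := V + 1) in H; [|lra].
        replace (d / (V + 1) * (V + 1)) with d in H by (field; lra). nra. }
      exists (d - Cmod (g s - g T)). split. lra. intros y Hy. apply Hd.
      pose proof (Cmod_sub_triangle y (g s) (g T)). lra.
Qed.

Lemma sph_hol_meromorphic a b f : (forall z, strip a b z -> sph_hol f z) ->
  (forall z, strip a b z -> ~ near_infty f z) -> meromorphic_on (strip a b) f.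
Proof.
  intros Hh Hn z0 Hz0.
  destruct (strip_open a b z0 Hz0) as (al & be & d & _ & Pd & Hd).
  assert (Hpt : forall z, Cmod (z - z0) < d -> f z <> CInfty ->
    f z = CFin (fin_part (f z)) /\ @ex_derive C_AbsRing C_NormedModule (fun y => fin_part (f y)) z).
  { intros z Hz Hf. split. destruct (f z); simpl; congruence.
    apply ex_derive_cdiff. destruct (Hh z) as (_ & H & _). apply Hd; auto. auto. }
  assert (H00 : Cmod (z0 - z0) < d) by (rewrite Cmod_sub_refl; auto).
  exists (fun z => fin_part (f z)).
  destruct (classic (f z0 = CInfty)) as [E|E].
  - destruct (infty_dichotomy f z0 d) as [Y|(e & Pe & He)]; auto.
    { intros z Hz. apply Hh, Hd; auto. } now apply Hn in Y.
    assert (Pm : 0 < Rmin d e) by now apply Rmin_pos.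
    exists (mkposreal _ Pm). simpl. pose proof (Rmin_l d e). pose proof (Rmin_r d e). split.
    + intros z Hz. apply Hpt. lra. apply He. lra.
    + rewrite E. apply filterlim_Cmod_infty. intros M.
      destruct (Hh z0 Hz0) as (Hc & _).
      pose proof (Rmax_l M 0). pose proof (Rmax_r M 0). set (M' := Rmax M 0) in *.
      destruct (Hc (2 / (M' + 1))) as (d1 & P1 & Hnear). apply Rdiv_lt_0_compat; lra.
      exists (Rmin d1 e). split. now apply Rmin_pos. intros y Hy.
      pose proof (Rmin_l d1 e). pose proof (Rmin_r d1 e).
      specialize (Hnear y ltac:(lra)). specialize (He y ltac:(lra)).
      rewrite E in Hnear. destruct (f y) as [w|]; [|congruence]. simpl fin_part. unfold rho in Hnear.
      pose proof (sqrt_1_Cmod_pos w). pose proof (sqrt_1_Cmod_sqr w) as S.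
      set (u := sqrt _) in *.
      assert (M' + 1 < u).
      { apply Rmult_lt_compat_r with (r := u) in Hnear; [|lra].
        apply Rmult_lt_compat_r with (r := M' + 1) in Hnear; [|lra].
        replace (2 / u * u * (M' + 1)) with (2 * (M' + 1)) in Hnear by (field; lra).
        replace (2 / (M' + 1) * u * (M' + 1)) with (2 * u) in Hnear by (field; lra). lra. }
      pose proof (Cmod_ge_0 w). simpl in S. nra.
  - assert (Hs0 : sph_cont f z0) by now apply Hh.
    destruct (sph_cont_away_infty f z0 Hs0 E) as (d1 & m & P1 & Pm & Ha).
    assert (Pd1 : 0 < Rmin d d1) by now apply Rmin_pos.
    pose proof (Rmin_l d d1). pose proof (Rmin_r d d1).
    exists (mkposreal _ Pd1). simpl. split.
    + intros z Hz. apply Hpt. lra. apply (away_infty_neq _ m); auto. apply Ha. lra.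
    + destruct (Hpt z0 H00 E) as [E1 E2]. destruct (f z0) as [w|]; [|congruence].
      split; auto.
Qed.

(** * Almost periodicity and the limit theorem *)

Lemma strip_translate alpha beta z (tau : R) : strip alpha beta z -> strip alpha beta (z + RtoC tau)%C.
Proof.
  unfold strip. replace (Im (z + RtoC tau)%C) with (Im z) by (unfold Im; simpl; ring). auto.
Qed.

Lemma almost_periodic_limit a b fn f :
  (forall n, meromorphic_almost_periodic a b (fn n)) ->
  converges_uniformly_inside a b fn f ->
  forall alpha beta, substrip alpha beta a b -> forall eps, 0 < eps ->
    relatively_dense (fun tau => forall z, strip alpha beta z ->
      rho (f (z + RtoC tau)%C) (f z) < eps).
Proof.
  intros Hap Hlim al be Hsub eps He.
  destruct (Hlim al be Hsub (eps / 3)) as [N HN]. lra.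
  specialize (HN N (le_n N)).
  destruct (Hap N) as [_ Hd]. destruct (Hd al be Hsub (eps / 3)) as (L & PL & HL). lra.
  exists L. split; auto. intros t. destruct (HL t) as (tau & Ht & Hz). exists tau. split; auto.
  intros z Hzs. pose proof (rho_triangle3 (f (z + RtoC tau)%C) (fn N (z + RtoC tau)%C) (fn N z) (f z)).
  pose proof (HN _ (strip_translate _ _ _ tau Hzs)) as H1. rewrite rho_sym in H1.
  specialize (HN z Hzs). specialize (Hz z Hzs). lra.
Qed.

Theorem theorem2 :
  forall (a b : Rbar), Rbar_lt a b ->
  forall (fn : nat -> C -> Cbar) (f : C -> Cbar),
    (forall n : nat, meromorphic_almost_periodic a b (fn n)) ->
    converges_uniformly_inside a b fn f ->
    meromorphic_almost_periodic a b f \/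
    (forall z : C, strip a b z -> f z = CInfty).
Proof.
  intros a b _ fn f Hap Hlim.
  assert (Hh : forall z, strip a b z -> sph_hol f z).
  { intros z0 Hz0. destruct (strip_open a b z0 Hz0) as (al & be & d & Hsub & Pd & Hd).
    apply (sph_hol_limit fn f z0 d). split; [|split]; auto.
    - intros n z Hz. apply (meromorphic_sph_hol (strip a b)). apply Hap. now apply Hd.
    - intros e He. destruct (Hlim al be Hsub e He) as [N HN]. exists N.
      intros z Hz. apply HN; auto. now apply Hd. }
  destruct (classic (exists z, strip a b z /\ near_infty f z)) as [(z1 & H1 & H2)|Hno].
  - right. now apply (near_infty_spreads a b f z1).
  - left. split.
    + apply sph_hol_meromorphic; auto. intros z Hz Hn. apply Hno. eauto.
    + now apply (almost_periodic_limit a b fn f).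
Qed.
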